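(* For any $u>0$ there exists a random subset $\mathcal I^u$ of $\mathbb Z^d$ (called the branching interlacement at level $u$) whose law is characterized by $$P[\mathcal I^u\cap K=\emptyset]=\exp(-u\cdot \mathrm{BCap}(K))\quad\text{for every finite } K\subset\mathbb Z^d ;$$ that is, such a random subset exists and its law is uniquely determined by this property.
   Context: Setting: $d\ge 5$; $\mathbb N=\{0,1,2,\dots\}$. $\mu$ is a probability measure on $\mathbb N$ with mean one and finite variance, not the Dirac mass at $1$. $\theta$ is a probability measure on $\mathbb Z^d$ with mean zero and finite range (finite support), not supported on any strict subgroup of $\mathbb Z^d$. The size-biased law is $\tilde\mu(k)=k\mu(k)$. Branching capacity. Let $\mathbf T^{\mathrm v}$ be the following random infinite plane (rooted ordered) tree, in which every non-root vertex is normal or special. The root produces $i\ge 1$ children with probability $\mu(i-1)$; the last child is special, the others are normal. A normal vertex produces only normal children, their number having law $\mu$. A special vertex produces a number of children with law $\tilde\mu$; one of them, chosen uniformly at random, is special, the others are normal. All choices are independent. The infinite path formed by the root and the special vertices is the spine. The past of the root is the set of vertices $v$ such that, for some non-root spine vertex $s$ with next spine vertex (special child) $s'$, either $v=s$ or $v$ is a descendant of (or equal to) a child of $s$ that comes after $s'$ in the order of the children of $s$. The random walk indexed by $\mathbf T^{\mathrm v}$ started at $x\in\mathbb Z^d$ is the random map $\mathcal S:\mathbf T^{\mathrm v}\to\mathbb Z^d$ with $\mathcal S(\text{root})=x$ and, conditionally on the tree, independent $\theta$-distributed increments $\mathcal S(v_2)-\mathcal S(v_1)$ along the oriented edges $(v_1,v_2)$;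 spine edges are oriented from child to parent, all other edges from parent to child. For finite $K\subset\mathbb Z^d$ and $x\in K$, $\mathrm{Es}_K(x)$ is the probability that no vertex of the past of the root is mapped into $K$ when the walk is started at $x$; and $\mathrm{BCap}(K)=\sum_{x\in K}\mathrm{Es}_K(x)$. *)

(* Defs.v *)
From HB Require Import structures.
From mathcomp Require Import all_boot all_order all_algebra finmap.
From mathcomp Require Import all_classical all_reals all_analysis.

Set Implicit Arguments.
Unset Strict Implicit.
Unset Printing Implicit Defensive.

Import Order.TTheory GRing.Theory Num.Theory.
Import numFieldNormedType.Exports.

Local Open Scope classical_set_scope.
Local Open Scope ring_scope.

Definition Zd (d : nat) := 'rV[int]_d.

HB.instance Definition _ (d : nat) := GRing.Zmodule.on (Zd d).
HB.instance Definition _ (d : nat) := Countable.on (Zd d).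
HB.instance Definition _ (d : nat) := isPointed.Build (Zd d) 0.

Section discrete_Zd.
Variable d : nat.

Let discrete_measurable0 : discrete_measurable (@set0 (Zd d)).
Proof. by []. Qed.

Let discrete_measurableC (A : set (Zd d)) :
  discrete_measurable A -> discrete_measurable (~` A).
Proof. by []. Qed.

Let discrete_measurableU (F : (set (Zd d))^nat) :
  (forall i, discrete_measurable (F i)) -> discrete_measurable (\bigcup_i F i).
Proof. by []. Qed.

HB.instance Definition _ := @isMeasurable.Build default_measure_display (Zd d)
  discrete_measurable discrete_measurable0 discrete_measurableC
  discrete_measurableU.

End discrete_Zd.

Section laws.
Context {R : realType} {d : nat}.

Definition critical_offspring (mu : probability nat R) : Prop :=
  [/\ ('E_mu[fun k : nat => k%:R : R] = 1)%E,
      ('V_mu[fun k : nat => k%:R : R] < +oo)%E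
    & (mu : set nat -> \bar R) <> \d_1%N].

Definition centered_step (theta : probability (Zd d) R) : Prop :=
  [/\ forall i : 'I_d, ('E_theta[fun z : Zd d => (z 0%R i)%:~R : R] = 0)%E,
      exists2 A : set (Zd d), finite_set A & theta A = 1%E
    & forall H : {pred Zd d}, zmod_closed H -> theta [set` H] = 1%E ->
        [set` H] = [set: Zd d]].

Definition size_biased (mu : probability nat R) (k : nat) : \bar R :=
  (k%:R%:E * mu [set k])%E.

(* Vertices are Ulam-Harris labels: the root is [::], and the children of [v]
   are [rcons v 0], ..., [rcons v (k - 1)], in this order. The root has i
   children, the special one included, with probability mu(i - 1). *)
Definition children_law (mu : probability nat R) (v : seq nat) (k : nat) :
    \bar R :=
  if v == [::] then (if k is i.+1 then mu [set i] else 0%E) else mu [set k].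

(* Joint law of the number of children of a special vertex and the rank,
   counted from 0, of its special child. *)
Definition special_law (mu : probability nat R) (kj : nat * nat) : \bar R :=
  if (kj.2 < kj.1)%N then (size_biased mu kj.1 * (kj.1%:R^-1)%:E)%E else 0%E.

End laws.

Section tree.
(* Both [N v] and [C v] are drawn at every label. [N v] is used when [v] is the
   root or a normal vertex, as its number of children; [C v] is used when [v] is
   special, as the pair (number of children, rank of the special child). *)
Variables (N : seq nat -> nat) (C : seq nat -> nat * nat).

(* The special child of the root is its last child. *)
Fixpoint spine (n : nat) : seq nat :=
  match n with
  | 0%N => [::]
  | 1%N => [:: (N [::]).-1]
  | m.+1 => rcons (spine m) (C (spine m)).2
  end.

Definition special (v : seq nat) : bool := (v != [::]) && (v == spine (size v)).

Definition nb_children (v : seq nat) : nat :=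
  if special v then (C v).1 else N v.

Definition vertices : set (seq nat) :=
  [set v | forall u i, prefix (rcons u i) v -> (i < nb_children u)%N].

Definition past : set (seq nat) :=
  [set v | vertices v /\
    exists2 n, (0 < n)%N &
      v = spine n \/
      exists2 i, ((C (spine n)).2 < i)%N & prefix (rcons (spine n) i) v].

(* [X v] is the increment along the oriented edge joining [v] to its parent;
   this edge points towards the parent when [v] is special. *)
Definition walk (V : zmodType) (X : seq nat -> V) (x : V) (v : seq nat) : V :=
  x + \sum_(1 <= m < (size v).+1)
        (if special (take m v) then - X (take m v) else X (take m v)).

End tree.

Section branching_capacity.
Context {R : realType} {d : nat} {dO : measure_display}
  {Omega : measurableType dO} {P : probability Omega R}.
Variables (N : seq nat -> {RV P >-> nat})
  (C : seq nat -> {RV P >-> (nat * nat)%type}) (X : seq nat -> {RV P >-> Zd d}).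

(* Mutual independence of the whole family (N v, C v, X v)_v with prescribed
   marginals; all variables being discrete, it is stated through the joint mass
   functions of finite subfamilies. *)
Definition walk_choices (mu : probability nat R) (theta : probability (Zd d) R) :
    Prop :=
  forall (J : seq (seq nat)) (n : seq nat -> nat) (c : seq nat -> nat * nat)
         (x : seq nat -> Zd d), uniq J ->
    P [set w | forall v, v \in J ->
                 [/\ N v w = n v, C v w = c v & X v w = x v]] =
    (\prod_(v <- J) (children_law mu v (n v) * special_law mu (c v) *
                     theta [set x v]))%E.

Definition Es (K : {fset Zd d}) (x : Zd d) : R :=
  fine (P [set w | forall v, past (N^~ w) (C^~ w) v ->
                     walk (N^~ w) (C^~ w) (X^~ w) x v \notin K]).

Definition BCap (K : {fset Zd d}) : R := \sum_(x <- K) Es K x.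

End branching_capacity.

Definition subsets (d : nat) :=
  g_sigma_algebraType [set [set A : set (Zd d) | A x] | x in [set: Zd d]].

HB.instance Definition _ (d : nat) := Measurable.on (subsets d).

Definition avoids {d : nat} (A : subsets d) (K : {fset Zd d}) : Prop :=
  (A : set (Zd d)) `&` [set` K] = set0.

(* Main.v *)
(* The avoidance function K |-> exp (- u BCap K) is completely monotone (all its
   iterated differences f K - f (x |: K) are nonnegative), which is what the
   probabilities of the events that K is missed and x_1, ..., x_n are hit require;
   a random set with this avoidance function is then read off a uniform variable
   by splitting [0, 1[ into nested intervals. Uniqueness is the pi-lambda
   theorem.

   For complete monotonicity, let q_n x K be the probability that the walk
   started at x and indexed by the first n generations of a critical tree avoids
   K. The branching recursion makes q_n x completely monotone, hence so is
   exp (- t (1 - q_n x)) and so is exp (- t \sum_x (1 - q_n x)). Decomposing the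
   tree along the ancestral line of its first vertex in K (in depth-first order)
   gives
     \sum_x (1 - q_n x K) = \sum_(i < n) \sum_(y in K) b_(i, n - i) y K,
   where b_(h, m) y K is the probability that the past of the root of T^v avoids
   K when it is truncated after h spine vertices and a number of generations
   growing with m. As b_(h, m) decreases to the escape probability, the
   right-hand side divided by n tends to BCap K (a Cesaro mean). *)

Require Import Defs.
From HB Require Import structures.
From mathcomp Require Import all_boot all_order all_algebra finmap.
From mathcomp Require Import all_classical all_reals all_analysis.
From mathcomp Require Import ring lra zify.

Set Implicit Arguments.
Unset Strict Implicit.
Unset Printing Implicit Defensive.

Import Order.TTheory GRing.Theory Num.Theory.
Import numFieldNormedType.Exports.

Local Open Scope classical_set_scope.
Local Open Scope ring_scope.

(** * Completely monotone functions of finite sets *)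

Section CM.
Context {R : realType} {T : choiceType}.
Implicit Types (f g : {fset T} -> R) (K L : {fset T}).

Definition fdiff f (x : T) K : R := f K - f (x |` K)%fset.

(** Complete monotonicity is cut at order n so that closure properties go by induction on n. A
    difference at a point already in K is 0, hence repeated points are harmless. *)
Fixpoint cmon_upto n f : Prop :=
  (forall K, 0 <= f K) /\
  if n is m.+1 then forall x, cmon_upto m (fdiff f x) else True.

Definition cmon f : Prop := forall n, cmon_upto n f.

Lemma cmon_upto_ge0 n f K : cmon_upto n f -> 0 <= f K.
Proof. by case: n => [|n] []. Qed.

Lemma cmon_ge0 f K : cmon f -> 0 <= f K.
Proof. by move=> /(_ 0%N); exact: cmon_upto_ge0. Qed.

Lemma cmon_uptoW n f : cmon_upto n.+1 f -> cmon_upto n f.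
Proof.
elim: n f => [|n ih] f [f0 fd]; first by split.
by split=> // x; apply: ih; exact: fd.
Qed.

Lemma cmon_fdiff f x : cmon f -> cmon (fdiff f x).
Proof. by move=> fc n; have [_] := fc n.+1; apply. Qed.

Lemma eq_cmon_upto n f g : f =1 g -> cmon_upto n f -> cmon_upto n g.
Proof. by move=> /funext ->. Qed.

Lemma cmon_upto_shift n f x :
  cmon_upto n f -> cmon_upto n (fun K => f (x |` K)%fset).
Proof.
elim: n f => [|n ih] f [f0 fd]; first by split.
split=> // y; apply: (@eq_cmon_upto _ (fun K => fdiff f y (x |` K)%fset)) => [K|].
  by rewrite /fdiff fsetUCA.
exact: (ih _ (fd y)).
Qed.

Lemma cmon_uptoD n f g : cmon_upto n f -> cmon_upto n g ->
  cmon_upto n (fun K => f K + g K).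
Proof.
elim: n f g => [|n ih] f g [f0 fd] [g0 gd].
  by split=> // K; rewrite addr_ge0.
split=> [K|x]; first by rewrite addr_ge0.
apply: (@eq_cmon_upto _ (fun K => fdiff f x K + fdiff g x K)) => [K|].
  by rewrite /fdiff opprD addrACA.
exact: (ih _ _ (fd x) (gd x)).
Qed.

(** A discrete Leibniz rule writes the difference of a product as a sum of two products, one of them
    with a factor shifted by x. *)
Lemma cmon_uptoM n f g : cmon_upto n f -> cmon_upto n g ->
  cmon_upto n (fun K => f K * g K).
Proof.
elim: n f g => [|n ih] f g.
  by move=> [f0 _] [g0 _]; split=> // K; rewrite mulr_ge0.
move=> fc gc; split=> [K|x].
  by rewrite mulr_ge0 ?(cmon_upto_ge0 _ fc)// (cmon_upto_ge0 _ gc).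
have [_ fd] := fc; have [_ gd] := gc.
apply: (@eq_cmon_upto _
  (fun K => fdiff f x K * g K + f (x |` K)%fset * fdiff g x K)) => [K|].
  by rewrite /fdiff mulrBl mulrBr addrA subrK.
apply: (@cmon_uptoD _ (fun K => fdiff f x K * g K)).
  exact: (ih _ _ (fd x) (cmon_uptoW gc)).
exact: (ih _ _ (cmon_upto_shift x (cmon_uptoW fc)) (gd x)).
Qed.

Lemma cmonD f g : cmon f -> cmon g -> cmon (fun K => f K + g K).
Proof. by move=> fc gc n; exact: cmon_uptoD. Qed.

Lemma cmonM f g : cmon f -> cmon g -> cmon (fun K => f K * g K).
Proof. by move=> fc gc n; exact: cmon_uptoM. Qed.

Lemma cmon_cst (c : R) : 0 <= c -> cmon (fun=> c).
Proof.
move=> c0 n; elim: n c c0 => [|n ih] c c0; first by split.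
split=> // x; apply: (@eq_cmon_upto _ (fun=> 0)); last exact: ih.
by move=> K; rewrite /fdiff subrr.
Qed.

(** The difference at x is the function itself, since the enlarged set contains x; differences at
    other points vanish. *)
Lemma cmon_notin (x : T) : cmon (fun K => (x \notin K)%:R).
Proof.
elim=> [|n ih]; split=> // y; have [yx|yx] := eqVneq x y.
  apply: eq_cmon_upto ih => K.
  by rewrite /fdiff in_fset1U yx eqxx subr0.
apply: (@eq_cmon_upto _ (fun=> 0)); last exact: cmon_cst.
by move=> K; rewrite /fdiff in_fset1U (negbTE yx) subrr.
Qed.

Lemma cmon_sum (I : Type) (s : seq I) (F : I -> {fset T} -> R) :
  (forall i, cmon (F i)) -> cmon (fun K => \sum_(i <- s) F i K).
Proof.
move=> Fc; elim: s => [|i s ih].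
  by under eq_fun do rewrite big_nil; exact: cmon_cst.
by under eq_fun do rewrite big_cons; apply: cmonD.
Qed.

Lemma cmon_prod (I : Type) (s : seq I) (F : I -> {fset T} -> R) :
  (forall i, cmon (F i)) -> cmon (fun K => \prod_(i <- s) F i K).
Proof.
move=> Fc; elim: s => [|i s ih].
  by under eq_fun do rewrite big_nil; exact: cmon_cst.
by under eq_fun do rewrite big_cons; apply: cmonM.
Qed.

Lemma cmonX f k : cmon f -> cmon (fun K => f K ^+ k).
Proof.
move=> fc; elim: k => [|k ih].
  by under eq_fun do rewrite expr0; exact: cmon_cst.
by under eq_fun do rewrite exprS; apply: cmonM.
Qed.

(** An iterated difference is a finite combination of values, so its sign survives pointwise
    limits. *)
Lemma cmon_lim (F : nat -> {fset T} -> R) f :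
  (forall n, cmon (F n)) -> (forall K, F ^~ K @ \oo --> f K) -> cmon f.
Proof.
move=> Fc Ff n; have {}Fc i := Fc i n.
have lim_ge0 (G : nat -> R) l : (forall i, 0 <= G i) -> G @ \oo --> l -> 0 <= l.
  move=> G0 Gl; rewrite -(cvg_lim _ Gl)//; apply: limr_ge; first exact: cvgP Gl.
  exact: nearW.
elim: n F f Fc Ff => [|n ih] F f Fc Ff.
  by split=> // K; apply: lim_ge0 (Ff K) => i; apply: cmon_upto_ge0 (Fc i).
split=> [K|x].
  by apply: lim_ge0 (Ff K) => i; apply: cmon_upto_ge0 (Fc i).
apply: (ih (fun i => fdiff (F i) x)) => [i|K].
  by have [_] := Fc i; exact.
by apply: cvgB; exact: Ff.
Qed.

(** The exponential series has nonnegative coefficients. *)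
Lemma cmon_expR f : cmon f -> cmon (fun K => expR (f K)).
Proof.
move=> fc; apply: (@cmon_lim (fun n K => series (exp_coeff (f K)) n)) => [n|K].
  rewrite /series/=; apply: cmon_sum => i; rewrite /exp_coeff.
  apply: cmonM; first exact: cmonX.
  by apply: cmon_cst; rewrite invr_ge0.
exact: is_cvg_series_exp_coeff.
Qed.

End CM.

(** * Random sets with a prescribed avoidance function *)

Section random_set.
Context {R : realType} {T : countType}.
Variable f : {fset T} -> R.

(** If f is the avoidance function of a random set, this is by inclusion-exclusion the probability
    of avoiding K and containing every point of L. *)
Definition iterdiff (L : seq T) : {fset T} -> R :=
  foldr (fun x g => fdiff g x) f L.

Lemma iterdiff_ge0 L K : cmon f -> 0 <= iterdiff L K.
Proof.
move=> fc; apply: cmon_ge0; elim: L => //= x L ih.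
exact: cmon_fdiff.
Qed.

(* A state (a, K, L) stands for the interval [a, a + iterdiff L K[, on which the
   random set contains the points of L and avoids those of K. *)
Definition state := (R * {fset T} * seq T)%type.

(** Values of w below the cut leave x out of the set, those above put x in; the right part of the
    interval has length [iterdiff (x :: L) K]. *)
Definition cut (st : state) (x : T) : R :=
  st.1.1 + iterdiff st.2 (x |` st.1.2)%fset.

Definition refine (w : R) (st : state) (x : T) : state :=
  if w < cut st x then (st.1.1, (x |` st.1.2)%fset, st.2)
  else (cut st x, st.1.2, x :: st.2).

Definition enum_upto (n : nat) : seq T := pmap (@choice.pickle_inv T) (iota 0 n).

Definition state0 : state := (0, fset0, [::]).

(** The splitting is run on the points of smaller code only, so the decision on x does not depend on
    how far the enumeration is continued. *)
Definition random_set (w : R) : set T :=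
  [set x | cut (foldl (refine w) state0 (enum_upto (choice.pickle x))) x <= w].

(** The same splitting run once along a list with its state carried along, a form suited to
    induction on the list. *)
Fixpoint misses (S : {fset T}) (w : R) (st : state) (s : seq T) : bool :=
  if s is x :: s' then
    ((x \notin S) || (w < cut st x)) && misses S w (refine w st x) s'
  else true.

Lemma missesP (S : {fset T}) w st s : uniq s ->
  reflect (forall x, x \in s -> x \in S ->
     w < cut (foldl (refine w) st (take (index x s) s)) x) (misses S w st s).
Proof.
elim: s st => [|y s ih] st /=; first by move=> _; exact: ReflectT.
move=> /andP[ys us]; apply: (iffP andP) => [[yS /(ih _ us) h] x|h].
  rewrite in_cons eq_sym; have [<- _ xS|/= _ xs xS] := eqVneq y x.
    by rewrite xS in yS.
  exact: h.
split.
  case: (boolP (y \in S)) => //= yS.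
  by have := h y (mem_head _ _) yS; rewrite eqxx.
apply/(ih _ us) => x xs xS.
have := h x; rewrite in_cons xs orbT => /(_ isT xS).
by case: eqVneq => // yx; rewrite yx xs in ys.
Qed.

Lemma measurable_misses S st s : measurable [set w | misses S w st s].
Proof.
elim: s st => [|x s ih] st /=.
  by rewrite (_ : [set _ | _] = setT)//; apply/seteqP; split.
rewrite (_ : [set _ | _] =
  (`]-oo, cut st x[ `&`
     [set w | misses S w (st.1.1, (x |` st.1.2)%fset, st.2) s])
  `|` (`[cut st x, +oo[ `&` (if x \in S then set0 else
     [set w | misses S w (cut st x, st.1.2, x :: st.2) s]))).
  apply: measurableU; apply: measurableI => //.
  by case: ifP.
apply/seteqP; split=> w /=; rewrite /refine !in_itv/=.
- case: ltP => cw; rewrite ?orbT ?orbF => /andP[xS h]; first by left.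
  by right; split=> //; rewrite (negbTE xS).
- case: ltP => cw; rewrite ?orbT ?orbF => -[[]|[]]// _.
  by case: ifP.
Qed.

(** Splitting at the cut of x gives two intervals of the same kind, the right one counting only when
    x is not in S. *)
Lemma lebesgue_misses (S : {fset T}) a K L s : cmon f ->
  lebesgue_measure (`[a, a + iterdiff L K[ `&` [set w | misses S w (a, K, L) s])
  = (iterdiff L (K `|` [fset x in s | x \in S])%fset)%:E.
Proof.
move=> fc; elim: s a K L => [|x s ih] a K L.
  have -> : [set w | misses S w (a, K, L) [::]] = setT.
    by apply/seteqP; split.
  rewrite setIT.
  rewrite lebesgue_measure_itv/= lte_fin ltrDl -EFinB addrAC subrr add0r.
  rewrite (_ : [fset _ in [::] | _]%fset = fset0) ?fsetU0; last first.
    by apply/fsetP => y; rewrite !inE.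
  case: ltP => // h; congr EFin; apply/eqP.
  by rewrite eq_le h iterdiff_ge0.
pose c := cut (a, K, L) x.
have ac : a <= c by rewrite lerDl iterdiff_ge0.
have cD : c + iterdiff (x :: L) K = a + iterdiff L K.
  by rewrite /c /cut /= /fdiff -addrA [_ + (_ - _)]addrC subrK.
have cb : c <= a + iterdiff L K by rewrite -cD lerDl iterdiff_ge0.
rewrite (_ : _ `&` _ =
  (`[a, c[ `&` [set w | misses S w (a, (x |` K)%fset, L) s]) `|`
  (if x \in S then set0 else `[c, c + iterdiff (x :: L) K[ `&`
     [set w | misses S w (c, K, x :: L) s])); last first.
  rewrite cD; apply/seteqP; split=> w /=; rewrite /refine !in_itv/=.
    rewrite -/c; case: (ltP w c) => cw; rewrite ?orbT ?orbF.
      by move=> [/andP[aw wb] /= h]; left; rewrite aw.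
    move=> [/andP[aw wb] /andP[xS h]]; right.
    by rewrite (negbTE xS)/= in_itv/= cw wb.
  rewrite -/c; move=> [[/andP[aw wc] h]|].
    by rewrite wc orbT aw (lt_le_trans wc).
  case: ifP => //= xS; rewrite in_itv/= => -[/andP[cw wb] h].
  by rewrite (le_trans ac) ?wb// ltNge cw.
rewrite measureU; last 3 first.
- by apply: measurableI => //; exact: measurable_misses.
- by case: ifP => // _; apply: measurableI => //; exact: measurable_misses.
- apply/seteqP; split=> // w [[/=]]; rewrite in_itv/= => /andP[_ wc] _.
  by case: ifP => //= _; rewrite in_itv/= leNgt wc => -[].
set S' := [fset y in s | y \in S]%fset.
transitivity ((iterdiff L ((x |` K) `|` S')%fset)%:E +
  (if x \in S then 0 else iterdiff (x :: L) (K `|` S')%fset)%:E)%E.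
  congr (_ + _)%E; first exact: (ih a (x |` K)%fset L).
  by case: ifP => _; [exact: measure0|exact: (ih c K (x :: L))].
case: ifPn => xS.
  rewrite adde0; congr (iterdiff _ _)%:E; apply/fsetP => y.
  by rewrite !inE; case: eqVneq => [->|]; rewrite ?xS ?orbT.
(* When x is unconstrained both halves count, and their lengths telescope. *)
rewrite /= /fdiff -EFinD addrC fsetUA subrK.
congr (iterdiff _ _)%:E; apply/fsetP => y; rewrite !inE.
by case: eqVneq => [->|//]; rewrite (negbTE xS) !andbF.
Qed.

End random_set.

Section random_set_law.
Context {R : realType} {T : countType}.
Variable f : {fset T} -> R.
Hypothesis fc : cmon f.

Lemma uniq_enum_upto n : uniq (enum_upto n : seq T).
Proof.
apply: (pmap_uniq (g := @choice.pickle T)); first exact: pickle_invK.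
exact: iota_uniq.
Qed.

(** The points preceding x are those of smaller code, whatever the length n; this matches
    [random_set] with [misses]. *)
Lemma take_enum_upto n (x : T) : (choice.pickle x < n)%N ->
  x \in (enum_upto n : seq T) /\
  take (index x (enum_upto n : seq T)) (enum_upto n : seq T) =
    enum_upto (choice.pickle x).
Proof.
move=> xn; have : uniq (enum_upto n : seq T) by exact: uniq_enum_upto.
have -> : enum_upto n = (enum_upto (choice.pickle x) ++
    x :: pmap (@choice.pickle_inv T)
           (iota (choice.pickle x).+1 (n - (choice.pickle x).+1)) : seq T).
  rewrite /enum_upto -{1}(subnKC xn) -addn1 iotaD iotaD !pmap_cat/= add0n.
  by rewrite pickleK_inv/= -catA addn1.
rewrite cat_uniq => /and3P[_ /= /norP[xe _] _]; split.
  by rewrite mem_cat mem_head orbT.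
by rewrite index_cat (negbTE xe)/= eqxx addn0 take_size_cat.
Qed.

Lemma random_set_misses (S : {fset T}) n w :
  (forall x, x \in S -> (choice.pickle x < n)%N) ->
  (random_set f w `&` [set` S] = set0) <-> misses f S w state0 (enum_upto n).
Proof.
move=> Sn; split=> [h|].
  apply/missesP => [|x xe xS]; first exact: uniq_enum_upto.
  have [_ ->] := take_enum_upto (Sn x xS); rewrite ltNge; apply/negP => xw.
  by have : (random_set f w `&` [set` S]) x by []; rewrite h.
move=> /(elimT (missesP _ _ _ _ (uniq_enum_upto n))) h.
apply/seteqP; split=> // x [/= + xS].
have [xe xt] := take_enum_upto (Sn x xS).
by have := h _ xe xS; rewrite xt ltNge => /negP.
Qed.

Lemma fset_bound (S : {fset T}) :
  exists n, forall x, x \in S -> (choice.pickle x < n)%N.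
Proof.
exists (\max_(x <- S) choice.pickle x).+1 => x xS.
by rewrite ltnS; apply: leq_bigmax_seq.
Qed.

Lemma measurable_random_set_misses (S : {fset T}) :
  measurable [set w | random_set f w `&` [set` S] = set0].
Proof.
have [n Sn] := fset_bound S.
rewrite (_ : [set _ | _] = [set w | misses f S w state0 (enum_upto n)]).
  exact: measurable_misses.
by apply/seteqP; split=> w /= /(random_set_misses w Sn).
Qed.

Hypothesis f0 : f fset0 = 1.

Lemma lebesgue_random_set_misses (S : {fset T}) :
  lebesgue_measure ([set w | random_set f w `&` [set` S] = set0] `&` `[0, 1[)
  = (f S)%:E.
Proof.
have [n Sn] := fset_bound S.
rewrite (_ : [set _ | _] = [set w | misses f S w state0 (enum_upto n)]);
  last first.
  by apply/seteqP; split=> w /= /(random_set_misses w Sn).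
have := lebesgue_misses S 0 fset0 [::] (enum_upto n) fc.
rewrite /= f0 add0r setIC => ->.
congr (f _)%:E; rewrite fset0U; apply/fsetP => x; rewrite !inE.
apply/andb_idl => xS.
by have [] := take_enum_upto (Sn x xS).
Qed.

End random_set_law.

(** The sample space is the whole real line, carrying the uniform law of the unit interval. *)
Definition lebesgue_unit (R : realType) : set (measurableTypeR R) -> \bar R :=
  mrestr lebesgue_measure (measurable_itv `[0%R, 1%R[).

HB.instance Definition _ (R : realType) := Measure.on (@lebesgue_unit R).

Lemma lebesgue_unitT (R : realType) : @lebesgue_unit R [set: _] = 1%E.
Proof.
rewrite /lebesgue_unit /mrestr setTI lebesgue_measure_itv/= lte_fin ltr01.
by rewrite oppr0 adde0.
Qed.

HB.instance Definition _ (R : realType) :=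
  @Measure_isProbability.Build _ _ R (@lebesgue_unit R) (@lebesgue_unitT R).

(** * Existence of the random subset and uniqueness of its law *)

Section random_subset.
Context {R : realType} {d : nat}.

Lemma ex_random_subset (f : {fset Zd d} -> R) : cmon f -> f fset0 = 1 ->
  exists (d1 : measure_display) (O1 : measurableType d1)
     (Q : probability O1 R) (I : {RV Q >-> subsets d}),
  forall K : {fset Zd d}, Q [set w | avoids (I w) K] = (f K)%:E.
Proof.
move=> fc f0.
have mI : measurable_fun [set: measurableTypeR R]
    (random_set f : measurableTypeR R -> subsets d).
  apply: (@measurability _ _ _ (subsets d) _ _
    [set [set A : set (Zd d) | A x] | x in [set: Zd d]]) => //.
  move=> _ [_ [x _ <-] <-]; rewrite setTI.
  rewrite (_ : _ @^-1` _ =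
    ~` [set w | random_set f w `&` [set` [fset x]%fset] = set0]).
    by apply: measurableC; exact: measurable_random_set_misses.
  apply/seteqP; split=> w /=.
    move=> wx h; have : (random_set f w `&` [set` [fset x]%fset]) x.
      by split=> //=; rewrite inE.
    by rewrite h.
  by move=> /eqP/set0P[y [wy /=]]; rewrite inE => /eqP <-.
pose I : {RV (@lebesgue_unit R) >-> subsets d} :=
  HB.pack (random_set f : measurableTypeR R -> subsets d)
    (isMeasurableFun.Build _ _ _ _ _ mI).
exists _, _, (@lebesgue_unit R : probability _ _), I => K.
exact: lebesgue_random_set_misses.
Qed.

(** Avoidance events form a pi-system, as avoiding K and L is avoiding their union, and they
    generate the sigma-algebra. *)
Lemma eq_random_subset_law (d1 d2 : measure_display) (O1 : measurableType d1)
   (O2 : measurableType d2) (Q1 : probability O1 R) (Q2 : probability O2 R)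
   (I1 : {RV Q1 >-> subsets d}) (I2 : {RV Q2 >-> subsets d}) :
  (forall K : {fset Zd d},
     Q1 [set w | avoids (I1 w) K] = Q2 [set w | avoids (I2 w) K]) ->
  forall B : set (subsets d), measurable B ->
    distribution Q1 I1 B = distribution Q2 I2 B.
Proof.
move=> h B mB.
pose H := [set [set A : subsets d | avoids A K] | K in [set: {fset Zd d}]].
have sG : [set [set A : set (Zd d) | A x] | x in [set: Zd d]] `<=` <<s H >>.
  move=> _ [x _ <-].
  rewrite (_ : [set _ | _] = ~` [set A : subsets d | avoids A [fset x]%fset]).
    rewrite -setTD; apply: sigma_algebraCD.
    by apply: sub_gen_smallest; exists [fset x]%fset.
  apply/seteqP; split=> A /=.
    move=> Ax; rewrite /avoids => e.
    have : ((A : set _) `&` [set` [fset x]%fset]) x by split=> //=; rewrite inE.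
    by rewrite e.
  by move=> /eqP/set0P[y [Ay /=]]; rewrite inE => /eqP <-.
have HB : <<s H >> B.
  move: mB; apply: (smallest_sub (smallest_sigma_algebra _ _)) => //.
have mH : H `<=` measurable.
  move=> _ [K _ <-].
  rewrite (_ : [set _ | _] = \bigcap_(x in [set` K])
      ~` [set A : subsets d | (A : set _) x]).
    apply: fin_bigcap_measurable => // x _; apply: measurableC.
    by apply: sub_gen_smallest; exists x.
  apply/seteqP; split=> A /=.
    move=> AK x xK Ax.
    by have : ((A : set _) `&` [set` K]) x by []; rewrite AK.
  by move=> h'; apply/seteqP; split=> // x [Ax xK]; exact: (h' x).
apply: (g_sigma_algebra_measure_unique H mH (fun=> setT)) HB => //.
- move=> _; exists fset0 => //; apply/seteqP; split=> // A _ /=.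
  by rewrite /avoids set_fset0 setI0.
- by rewrite bigcup_const.
- move=> _ _ [K _ <-] [L _ <-]; exists (K `|` L)%fset => //.
  apply/seteqP; split=> A; rewrite /= /avoids set_fsetU setIUr.
    by rewrite setU_eq0.
  by move=> [-> ->]; rewrite setU0.
- by move=> _ [K _ <-]; exact: h.
- by move=> _; apply: (le_lt_trans (probability_le1 _ _)); rewrite ?ltry.
Qed.

End random_subset.

(** * Independence of discrete families *)

Section countable_esum.
Local Open Scope ereal_scope.
Context {R : realType} {T : countType}.
Implicit Types a : T -> \bar R.

Lemma esum_nneseries a : (forall x, 0 <= a x) ->
  \esum_(x in [set: T]) a x =
  \sum_(n <oo) oapp a 0 (@choice.pickle_inv T n).
Proof.
move=> a0; rewrite nneseries_esumT => [|n]; last by case: (choice.pickle_inv _) => //=.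
have bij : set_bij [set: T] (range (@choice.pickle T)) (@choice.pickle T).
  by apply: inj_bij => x y _ _ /(pcan_inj (@choice.pickleK T)).
transitivity (\esum_(x in [set: T])
    oapp a 0 (@choice.pickle_inv T (choice.pickle x))).
  by apply: eq_esum => x _; rewrite pickleK_inv.
rewrite -(reindex_esum _ _ _ (fun n => oapp a 0 (@choice.pickle_inv T n)) bij).
rewrite [LHS]esum_mkcond; apply: eq_esum => n _.
case: ifPn => // /negP nr; case e : (choice.pickle_inv n) => [x|//] /=.
exfalso; apply: nr; apply/mem_set; exists x => //.
by have := @pickle_invK T n; rewrite e.
Qed.

Lemma esumZl a (c : R) : (forall x, 0 <= a x) -> (0 <= c)%R ->
  \esum_(x in [set: T]) (c%:E * a x) = c%:E * \esum_(x in [set: T]) a x.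
Proof.
move=> a0 c0; rewrite !esum_nneseries// => [|x]; last exact: mule_ge0.
rewrite -nneseriesZl// => [|n _]; last by case: (choice.pickle_inv _) => //=.
by apply: eq_eseriesr => n _; case: (choice.pickle_inv _) => //=; rewrite mule0.
Qed.

End countable_esum.

Section measure_fibers.
Local Open Scope ereal_scope.
Context {R : realType} {d : measure_display} {Omega : measurableType d}.
Variable P : {measure set Omega -> \bar R}.

(** Countable additivity over the values of g; this is the form in which conditioning on a discrete
    variable appears below. *)
Lemma measure_esum_fibers (T : countType) (g : Omega -> T) (E : set Omega) :
  (forall y, measurable [set w | g w = y]) -> measurable E ->
  P E = \esum_(y in [set: T]) P (E `&` [set w | g w = y]).
Proof.
move=> mg mE; rewrite esum_nneseries//.
pose F n := if @choice.pickle_inv T n is Some y then E `&` [set w | g w = y]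
  else set0.
have mF n : measurable (F n).
  by rewrite /F; case: (choice.pickle_inv _) => // y; exact: measurableI.
have EF : E = \bigcup_n F n.
  apply/seteqP; split=> w.
    move=> Ew; exists (choice.pickle (g w)) => //.
    by rewrite /F pickleK_inv.
  by move=> [n _]; rewrite /F; case: (choice.pickle_inv _) => // y [].
rewrite {1}EF measure_semi_bigcup//.
- apply: eq_eseriesr => n _; rewrite /F.
  by case: (choice.pickle_inv _) => //=; rewrite measure0.
- apply/trivIsetP => m n _ _ mn; rewrite /F.
  case em: (@choice.pickle_inv T m) => [y|]; last by rewrite set0I.
  case en: (@choice.pickle_inv T n) => [z|]; last by rewrite setI0.
  apply/seteqP; split=> // w [[_ /= gy] [_ /= gz]].
  have := @pickle_invK T m; have := @pickle_invK T n.
  by rewrite em en /= -gy -gz => -> nm; rewrite nm eqxx in mn.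
- exact: bigcupT_measurable.
Qed.

End measure_fibers.

Section independent_family.
Local Open Scope ereal_scope.
Context {R : realType} {d : measure_display} {Omega : measurableType d}
  {P : probability Omega R} {I : eqType} {V : countType}.
Variables (Y : I -> Omega -> V) (p : I -> V -> \bar R).
Hypothesis mY : forall i y, measurable [set w | Y i w = y].
Hypothesis PY : forall (J : seq I) (y : I -> V), uniq J ->
  P [set w | forall i, i \in J -> Y i w = y i] = \prod_(i <- J) p i (y i).

Definition cylinder (J : seq I) (y : I -> V) : set Omega :=
  [set w | forall i, i \in J -> Y i w = y i].

(** The empty set is included because two cylinders prescribing different values at one index do not
    meet, and a pi-system is wanted. *)
Definition cylinders (A : set I) : set (set Omega) :=
  [set E | E = set0 \/ exists J y,
    [/\ uniq J, [set` J] `<=` A & E = cylinder J y]].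

Definition events (A : set I) : set (set Omega) := <<s cylinders A >>.

Lemma measurable_cylinder J y : measurable (cylinder J y).
Proof.
rewrite (_ : cylinder J y = \bigcap_(i in [set` J]) [set w | Y i w = y i]).
  exact: fin_bigcap_measurable.
by apply/seteqP; split=> w /= h i; exact: h.
Qed.

Lemma cylinders_measurable A : cylinders A `<=` measurable.
Proof. by move=> E [->//|[J [y [_ _ ->]]]]; exact: measurable_cylinder. Qed.

Lemma events_measurable A : events A `<=` measurable.
Proof.
apply: smallest_sub; first exact: sigma_algebra_measurable.
exact: cylinders_measurable.
Qed.

Lemma events_sub A B E : A `<=` B -> events A E -> events B E.
Proof.
move=> AB; apply: smallest_sub; first exact: smallest_sigma_algebra.
move=> F [->|[J [y [uJ JA ->]]]].
  by apply: sub_gen_smallest; left.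
by apply: sub_gen_smallest; right; exists J, y; split=> // i /JA/AB.
Qed.

Lemma setI_closed_cylinders A : setI_closed (cylinders A).
Proof.
move=> E F [->|[J [y [uJ JA ->]]]]; first by left; rewrite set0I.
move=> [->|[J' [y' [uJ' JA' ->]]]]; first by left; rewrite setI0.
have [yy'|] := pselect (forall i, i \in J -> i \in J' -> y i = y' i); last first.
  move=> /existsNP[i /not_implyP[iJ /not_implyP[iJ' yi]]]; left.
  apply/seteqP; split=> // w [/= h h']; apply: yi.
  by rewrite -(h _ iJ) -(h' _ iJ').
right; exists (undup (J ++ J')), (fun i => if i \in J then y i else y' i).
split.
- exact: undup_uniq.
- by move=> i /=; rewrite mem_undup mem_cat => /orP[/JA|/JA'].
- apply/seteqP; split=> w /=.
    move=> [h h'] i; rewrite mem_undup mem_cat.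
    by case: ifPn => iJ /=; [rewrite h|move=> iJ'; rewrite h'].
  move=> h; split=> i iJ.
    by rewrite h ?iJ// mem_undup mem_cat iJ.
  rewrite h ?mem_undup ?mem_cat ?iJ ?orbT//.
  by case: ifPn => // iJ'; rewrite yy'.
Qed.

Lemma cylindersT A : cylinders A setT.
Proof.
right; exists [::], (fun i => Y i point); split=> //.
by apply/seteqP; split.
Qed.

Lemma indep_cylinders A B E F : A `&` B = set0 -> cylinders A E ->
  cylinders B F -> P (E `&` F) = P E * P F.
Proof.
move=> AB [->|[J [y [uJ JA ->]]]]; first by rewrite set0I measure0 mul0e.
move=> [->|[J' [y' [uJ' JB' ->]]]]; first by rewrite setI0 measure0 mule0.
have JJ' i : i \in J' -> i \notin J.
  move=> iJ'; apply/negP => iJ.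
  have : (A `&` B) i by split; [exact: JA|exact: JB'].
  by rewrite AB.
pose y'' i := if i \in J then y i else y' i.
have -> : cylinder J y `&` cylinder J' y' =
    [set w | forall i, i \in J ++ J' -> Y i w = y'' i].
  apply/seteqP; split=> w /=.
    move=> [h h'] i; rewrite /y'' mem_cat.
    by case: ifPn => iJ /=; [rewrite h|move=> iJ'; rewrite h'].
  move=> h; split=> i iJ.
    by rewrite h /y'' ?iJ// mem_cat iJ.
  by rewrite h /y'' ?(negbTE (JJ' _ iJ))// mem_cat iJ orbT.
rewrite PY; last first.
  rewrite cat_uniq uJ uJ' andbT/=; apply/hasPn => i /JJ'//.
rewrite big_cat /cylinder !PY//; congr (_ * _); rewrite big_seq [RHS]big_seq.
  by apply: eq_bigr => i iJ; rewrite /y'' iJ.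
by apply: eq_bigr => i iJ; rewrite /y'' (negbTE (JJ' _ iJ)).
Qed.

(** Both sides are finite measures in E that agree on a pi-system, hence on the sigma-algebra it
    generates. *)
Lemma indep_extend (G : set (set Omega)) F : G `<=` measurable -> G setT ->
  setI_closed G -> measurable F ->
  (forall E, G E -> P (E `&` F) = P E * P F) ->
  forall E, <<s G >> E -> P (E `&` F) = P E * P F.
Proof.
move=> mG GT GI mF h E GE.
have PF0 : (0 <= fine (P F))%R by rewrite fine_ge0.
have e A : P A * P F = mscale (NngNum PF0) P A.
  by rewrite /mscale/= fineK ?fin_num_measure// muleC.
rewrite e; apply: (g_sigma_algebra_measure_unique G mG (fun=> setT)
  _ _ (mrestr P mF) (mscale (NngNum PF0) P)) GE => //.
- by rewrite bigcup_const.
- move=> A GA; exact: etrans (h A GA) (e A).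
- move=> _; have : P ([set: Omega] `&` F) < +oo; last exact.
  by rewrite setTI ltey_eq fin_num_measure.
Qed.

(** Cylinders are replaced by general events on one side at a time. *)
Lemma indep_events A B E F : A `&` B = set0 -> events A E -> events B F ->
  P (E `&` F) = P E * P F.
Proof.
move=> AB AE BF.
apply: indep_extend AE => //.
- exact: cylinders_measurable.
- exact: cylindersT.
- exact: setI_closed_cylinders.
- exact: events_measurable BF.
move=> C AC; rewrite setIC muleC.
apply: indep_extend BF => //.
- exact: cylinders_measurable.
- exact: cylindersT.
- exact: setI_closed_cylinders.
- exact: cylinders_measurable AC.
by move=> D BD; rewrite setIC muleC; exact: indep_cylinders AC BD.
Qed.

Lemma eventsI A E F : events A E -> events A F -> events A (E `&` F).
Proof.
by move=> AE AF; exact: (@measurableI _ (g_sigma_algebraType (cylinders A))).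
Qed.

Lemma events_bigcup A (T : countType) (F : T -> set Omega) :
  (forall t, events A (F t)) -> events A (\bigcup_t F t).
Proof.
move=> AF.
apply: (@countable_bigcupT_measurable _ (g_sigma_algebraType (cylinders A))) => //.
Qed.

Lemma events0 A : events A set0.
Proof. exact: (@measurable0 _ (g_sigma_algebraType (cylinders A))). Qed.

Lemma eventsT A : events A setT.
Proof. exact: (@measurableT _ (g_sigma_algebraType (cylinders A))). Qed.

Lemma events_val (A : set I) i (Q : set V) : A i ->
  events A [set w | Q (Y i w)].
Proof.
move=> Ai; rewrite (_ : [set _ | _] =
  \bigcup_y (if y \in Q then [set w | Y i w = y] else set0)).
  apply: events_bigcup => y; case: ifP => _; last exact: events0.
  apply: sub_gen_smallest; right; exists [:: i], (fun=> y); split=> //.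
    by move=> j /=; rewrite inE => /eqP ->.
  apply/seteqP; split=> w /= h; last by rewrite h// inE.
  by move=> j; rewrite inE => /eqP ->.
apply/seteqP; split=> w /=.
  by move=> Qw; exists (Y i w) => //; rewrite mem_set.
by move=> [y _]; case: ifPn => // /set_mem Qy /= ->.
Qed.

Lemma events_forall A (s : seq nat) (E : nat -> set Omega) :
  (forall k, k \in s -> events A (E k)) ->
  events A [set w | forall k, k \in s -> E k w].
Proof.
elim: s => [|k s ih] AE.
  by rewrite (_ : [set _ | _] = setT); [exact: eventsT|apply/seteqP; split].
rewrite (_ : [set _ | _] = E k `&` [set w | forall k, k \in s -> E k w]).
  apply: eventsI; first by apply: AE; rewrite mem_head.
  by apply: ih => j js; apply: AE; rewrite in_cons js orbT.
apply/seteqP; split=> w /=.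
  move=> h; split; first by apply: h; rewrite mem_head.
  by move=> j js; apply: h; rewrite in_cons js orbT.
by move=> [hk h] j; rewrite in_cons => /orP[/eqP ->//|/h].
Qed.

Lemma indep_events_forall (s : seq nat) (A : nat -> set I) (E : nat -> set Omega) :
  uniq s -> (forall j k, j != k -> A j `&` A k = set0) ->
  (forall k, events (A k) (E k)) ->
  P [set w | forall k, k \in s -> E k w] = \prod_(k <- s) P (E k).
Proof.
move=> + AA AE; elim: s => [|k s ih] /=.
  move=> _; rewrite big_nil -(@probability_setT _ _ _ P).
  by congr (P _); apply/seteqP; split.
move=> /andP[ks us]; rewrite big_cons -ih//.
rewrite -(@indep_events (A k) (\bigcup_(j in [set` s]) A j))//.
- congr (P _); apply/seteqP; split=> w /=.
    move=> h; split; first by apply: h; rewrite mem_head.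
    by move=> j js; apply: h; rewrite in_cons js orbT.
  by move=> [hk h] j; rewrite in_cons => /orP[/eqP ->//|/h].
- rewrite setI_bigcupr; apply: bigcup0 => j js; apply: AA.
  by apply: contra ks => /eqP ->.
- apply: events_forall => j js; apply: (events_sub (A := A j)) => [i Ai|//].
  by exists j.
Qed.

Lemma prob_val i y : P [set w | Y i w = y] = p i y.
Proof.
have := @PY [:: i] (fun=> y) isT; rewrite big_seq1 => <-.
congr (P _); apply/seteqP; split=> w /= h; last by rewrite h// inE.
by move=> j; rewrite inE => /eqP ->.
Qed.

End independent_family.

(** * Walks indexed by truncated trees *)

Section explored_events.
Context {V : zmodType}.
Variables (N : seq nat -> nat) (C : seq nat -> nat * nat) (X : seq nat -> V).
Variable K : {fset V}.

(* x is the position of the parent of v, and n the number of generations. *)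
Fixpoint bush (n : nat) (v : seq nat) (x : V) : Prop :=
  if n is n'.+1 then
    x + X v \notin K /\
    forall i, (i < N v)%N -> bush n' (rcons v i) (x + X v)
  else True.

(* [backbone h n u y]: u being special, with its parent at y, the walk avoids K
   at the h spine vertices starting from u, and on the first n, n + 1, ...
   generations of the normal trees attached to their right. *)
Fixpoint backbone (h n : nat) (u : seq nat) (y : V) : Prop :=
  if h is h'.+1 then
    [/\ y - X u \notin K,
        forall i, ((C u).2 < i)%N -> (i < (C u).1)%N ->
          bush n (rcons u i) (y - X u)
      & backbone h' n.+1 (rcons u (C u).2) (y - X u)]
  else True.

Lemma backbone_mono h h' n n' u x : (h <= h')%N -> (n <= n')%N ->
  backbone h' n' u x -> backbone h n u x.
Proof.
have bush_mono k k' v z : (k <= k')%N -> bush k' v z -> bush k v z.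
  elim: k k' v z => // k ih [//|k'] v z kk' [h0 h1].
  by split=> // i iN; apply: ih (h1 _ iN).
elim: h h' n n' u x => // h ih [//|h'] n n' u x hh' nn' [h0 h1 h2].
split=> // [i i1 i2|]; first exact: bush_mono (h1 _ i1 i2).
exact: ih h2.
Qed.

End explored_events.

Section esum_finite.
Context {R : realType} {T : choiceType}.

Lemma esum_seq (s : seq T) (a : T -> \bar R) : uniq s -> (forall x, (0 <= a x)%E) ->
  (forall x, x \notin s -> a x = 0%E) ->
  (\esum_(x in [set: T]) a x = \sum_(x <- s) a x)%E.
Proof.
move=> us a0 as0.
have -> : (\esum_(x in [set: T]) a x = \esum_(x in [set` s]) a x)%E.
  rewrite [RHS]esum_mkcond; apply: eq_esum => x _; case: ifPn => // xs.
  by apply: as0; apply: contra xs => xs; apply/mem_set.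
rewrite esum_fset//; first by rewrite -fsbig_seq.
Qed.

End esum_finite.

Lemma prod_cst {R : realType} {I : Type} (s : seq I) (c : R) :
  (\prod_(i <- s) c%:E = (c ^+ size s)%:E)%E.
Proof.
by elim: s => [|i s ih]; rewrite ?big_nil// big_cons ih /= exprS EFinM.
Qed.

(** * Recursive formulas for the avoidance probabilities *)

Section avoidance_recursion.
Context {R : realType} {d : nat} (mu : probability nat R)
  (theta : probability (Zd d) R).

Definition offspring (k : nat) : R := fine (mu [set k]).

Definition step_law (z : Zd d) : R := fine (theta [set z]).

Lemma offspring_ge0 k : 0 <= offspring k. Proof. by rewrite fine_ge0. Qed.

Lemma step_law_ge0 z : 0 <= step_law z. Proof. by rewrite fine_ge0. Qed.

(* With g the generating function of mu, this is (1 - g a) / (1 - a). *)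
Definition genquot (a : R) : R :=
  fine (\esum_(k in [set: nat]) (offspring k * \sum_(j < k) a ^+ j)%:E)%E.

Variables (S : seq (Zd d)) (K : {fset Zd d}).

(** This will be the probability of [bush]: S is meant to contain the support of theta, and the last
    factor is the generating function of mu at the value for the children. *)
Fixpoint bush_avoid (n : nat) (x : Zd d) : R :=
  if n is n'.+1 then
    \sum_(z <- S) step_law z * ((x + z \notin K)%:R *
      (1 - (1 - bush_avoid n' (x + z)) * genquot (bush_avoid n' (x + z))))
  else 1.

(** The siblings to the right of a special child of rank j number k - j - 1; summing a^(k-j-1) over
    j < k with weights mu(k) gives [genquot] at a. *)
Fixpoint backbone_avoid (h n : nat) (y : Zd d) : R :=
  if h is h'.+1 then
    \sum_(z <- S) step_law z * ((y - z \notin K)%:R *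
      (genquot (bush_avoid n (y - z)) * backbone_avoid h' n.+1 (y - z)))
  else 1.

End avoidance_recursion.

Section walk_laws.
Context {R : realType} {d : nat} {mu : probability nat R}
  {theta : probability (Zd d) R} {dO : measure_display}
  {Omega : measurableType dO} {P : probability Omega R}
  {N : seq nat -> {RV P >-> nat}} {C : seq nat -> {RV P >-> (nat * nat)%type}}
  {X : seq nat -> {RV P >-> Zd d}}.
Hypothesis hNCX : walk_choices N C X mu theta.

(** The three choices at a label form one variable with countably many values, so that the results
    on independent families apply. *)
Let V : countType := ((nat * (nat * nat)) * Zd d)%type.
Let Y (v : seq nat) (w : Omega) : V := (N v w, C v w, X v w).
Let p (v : seq nat) (y : V) : \bar R :=
  (children_law mu v y.1.1 * special_law mu y.1.2 * theta [set y.2])%E.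

Let mN v n : measurable [set w | N v w = n].
Proof.
rewrite -[X in measurable X]setTI.
exact: (measurable_funP (N v) _ [set n]).
Qed.

Let mX v x : measurable [set w | X v w = x].
Proof.
rewrite -[X in measurable X]setTI.
exact: (measurable_funP (X v) _ [set x]).
Qed.

Let mC v c : measurable [set w | C v w = c].
Proof.
rewrite -[X in measurable X]setTI; apply: (measurable_funP (C v) _ [set c]) => //.
have -> : [set c] = [set c.1] `*` [set c.2].
  by case: c => a b; apply/seteqP; split=> [x ->//|[x y] [/= -> ->]].
exact: measurableX.
Qed.

Let mY v y : measurable [set w | Y v w = y].
Proof.
have -> : [set w | Y v w = y] = [set w | N v w = y.1.1] `&`
    [set w | C v w = y.1.2] `&` [set w | X v w = y.2].
  case: y => [[n c] x]; apply/seteqP; split=> w /=; first by case=> -> -> ->.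
  by rewrite /Y => -[[-> ->] ->].
by apply: measurableI => //; exact: measurableI.
Qed.

Let PY (J : seq (seq nat)) (y : seq nat -> V) : uniq J ->
  (P [set w | forall i, i \in J -> Y i w = y i] = \prod_(i <- J) p i (y i))%E.
Proof.
move=> uJ; rewrite /p -(@hNCX J (fun v => (y v).1.1) (fun v => (y v).1.2))//.
congr (P _); apply/seteqP; split=> w /= h v vJ.
  by rewrite -(h v vJ).
by have [] := h v vJ; rewrite /Y; case: (y v) => [[n c] x] /= -> -> ->.
Qed.

Let m := offspring mu.
Let th := step_law theta.

Let muE k : mu [set k] = (m k)%:E. Proof. by rewrite fineK// fin_num_measure. Qed.
Let thetaE z : theta [set z] = (th z)%:E.
Proof. by rewrite fineK// fin_num_measure. Qed.

Lemma esum_offspring : (\esum_(k in [set: nat]) (m k)%:E = 1)%E.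
Proof.
rewrite -(probability_setT mu) (@measure_esum_fibers _ _ nat mu nat id)//.
by apply: eq_esum => k _; rewrite setTI -muE.
Qed.

Lemma esum_step_law : (\esum_(z in [set: Zd d]) (th z)%:E = 1)%E.
Proof.
rewrite -(probability_setT theta) (@measure_esum_fibers _ _ (Zd d) theta (Zd d) id)//.
by apply: eq_esum => z _; rewrite setTI -thetaE.
Qed.

(** In [special_law] the size bias k cancels against the uniform choice 1/k of the rank, leaving
    mu(k) for each rank below k. *)
Let s (c : nat * nat) : R := if (c.2 < c.1)%N then m c.1 else 0.
Let s_ge0 c : 0 <= s c.
Proof. by rewrite /s; case: ifP => // _; exact: offspring_ge0. Qed.

Let specialE c : special_law mu c = (s c)%:E.
Proof.
rewrite /special_law /s; case: ifP => // c12.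
rewrite /size_biased muE -!EFinM mulrAC divff ?mul1r//.
by rewrite pnatr_eq0 -lt0n (leq_ltn_trans _ c12).
Qed.

Let childrenE v n : v != [::] -> children_law mu v n = (m n)%:E.
Proof. by rewrite /children_law => /negbTE ->; rewrite muE. Qed.

Lemma prob_special_step v c z : v != [::] ->
  P ([set w | C v w = c] `&` [set w | X v w = z]) = (s c * th z)%:E.
Proof.
move=> v0; rewrite (measure_esum_fibers P (mN v)); last exact: measurableI.
rewrite -[RHS]mule1 -esum_offspring -esumZl//; last 2 first.
- by move=> k; rewrite lee_fin offspring_ge0.
- by rewrite mulr_ge0 ?s_ge0 ?step_law_ge0.
apply: eq_esum => n _.
transitivity (p v (n, c, z)); last first.
  by rewrite /p/= childrenE// specialE thetaE -!EFinM -mulrA mulrC.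
rewrite -(prob_val PY); congr (P _).
by apply/seteqP; split=> w /=; [move=> [[<- <-] <-]|rewrite /Y => -[-> -> ->]].
Qed.

(** The total mass is read off the sample space, which the fibres of [C v] and [X v] exhaust. It
    serves to integrate [C] out below. *)
Lemma esum_special : (\esum_(c in [set: nat * nat]) (s c)%:E = 1)%E.
Proof.
pose v := [:: 0%N].
rewrite -(@probability_setT _ _ _ P) (measure_esum_fibers P (mC v))//.
apply: eq_esum => c _; rewrite setTI (measure_esum_fibers P (mX v))//.
rewrite -[LHS]mule1 -esum_step_law -esumZl ?s_ge0//; last first.
  by move=> z; rewrite lee_fin step_law_ge0.
by apply: eq_esum => z _; apply/esym; rewrite -EFinM; exact: prob_special_step.
Qed.

Lemma prob_children_step v n z : v != [::] ->
  P ([set w | N v w = n] `&` [set w | X v w = z]) = (m n * th z)%:E.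
Proof.
move=> v0; rewrite (measure_esum_fibers P (mC v)); last exact: measurableI.
rewrite -[RHS]mule1 -esum_special -esumZl//; last first.
  by rewrite mulr_ge0 ?offspring_ge0 ?step_law_ge0.
apply: eq_esum => c _.
transitivity (p v (n, c, z)); last first.
  by rewrite /p/= childrenE// specialE thetaE -!EFinM mulrAC.
rewrite -(prob_val PY); congr (P _).
by apply/seteqP; split=> w /=; [move=> [[<- <-] <-]|rewrite /Y => -[-> -> ->]].
Qed.


Lemma esum_special_rank :
  (\esum_(k in [set: nat]) \esum_(j in [set: nat]) (s (k, j))%:E = 1)%E.
Proof.
rewrite (@esum_esum _ _ _ _ (fun=> setT) (fun k j => (s (k, j))%:E)) => [|i j _ _].
  rewrite -esum_special (_ : _ `*`` _ = setT); last by apply/seteqP; split.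
  by apply: eq_esum => -[k j] _.
by rewrite lee_fin s_ge0.
Qed.

Lemma esum_rank (a : nat -> R) k : (forall j, 0 <= a j) ->
  (\esum_(j in [set: nat]) (s (k, j) * a j)%:E = (m k * \sum_(j < k) a j)%:E)%E.
Proof.
move=> a0; rewrite (@esum_seq _ _ (iota 0 k)) ?iota_uniq// => [|j|j].
- rewrite sumEFin; congr EFin.
  rewrite (_ : iota 0 k = index_iota 0 k); last by rewrite /index_iota subn0.
  rewrite big_mkord mulr_sumr; apply: eq_bigr => j _.
  by rewrite /s/= ltn_ord.
- by rewrite lee_fin mulr_ge0.
- by rewrite mem_iota leq0n add0n /s/= => /negbTE ->; rewrite mul0r.
Qed.

Let genquot_term_ge0 (a : R) k : 0 <= a ->
  (0 <= (m k * \sum_(j < k) a ^+ j)%:E)%E.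
Proof.
move=> a0; rewrite lee_fin mulr_ge0 ?offspring_ge0// sumr_ge0// => j _.
by rewrite exprn_ge0.
Qed.

(** For a at most 1 the sum is dominated by its value at 1, the total mass of the special law, hence
    it is finite. *)
Lemma genquotE (a : R) : 0 <= a <= 1 ->
  (\esum_(k in [set: nat]) (m k * \sum_(j < k) a ^+ j)%:E = (genquot mu a)%:E)%E.
Proof.
move=> /andP[a0 a1]; rewrite fineK// ge0_fin_numE; last first.
  by apply: esum_ge0 => k _; exact: genquot_term_ge0.
apply: (@le_lt_trans _ _ 1%E); last by rewrite ltry.
rewrite -esum_special_rank; apply: le_esum => k _.
rewrite -esum_rank => [|j]; last by rewrite exprn_ge0.
apply: le_esum => j _; rewrite lee_fin ler_piMr//.
exact: exprn_ile1.
Qed.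

Lemma genquot_ge0 (a : R) : 0 <= a -> 0 <= genquot mu a.
Proof.
move=> a0; rewrite fine_ge0// esum_ge0// => k _.
exact: genquot_term_ge0.
Qed.

(** The geometric identity giving 1 - a^k is applied termwise and summed against mu. *)
Lemma esum_genfun (a : R) : 0 <= a <= 1 ->
  (\esum_(k in [set: nat]) (m k * a ^+ k)%:E = (1 - (1 - a) * genquot mu a)%:E)%E.
Proof.
move=> a01; have /andP[a0 a1] := a01.
have a1' : 0 <= 1 - a by rewrite subr_ge0.
suff : (\esum_(k in [set: nat]) (m k * a ^+ k)%:E +
    ((1 - a) * genquot mu a)%:E = 1)%E.
  by move=> h; rewrite EFinB -h addeK.
rewrite EFinM -genquotE// -esumZl//; last first.
  by move=> k; exact: genquot_term_ge0.
rewrite -esumD => [|k _|k _]; last 2 first.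
- by rewrite lee_fin mulr_ge0 ?offspring_ge0 ?exprn_ge0.
- by rewrite mule_ge0 ?genquot_term_ge0.
rewrite -esum_offspring; apply: eq_esum => k _.
rewrite -EFinM -EFinD; congr EFin.
have := subrX1 a k => h.
have {}h : (1 - a) * (\sum_(i < k) a ^+ i) = 1 - a ^+ k.
  by apply: oppr_inj; rewrite -mulNr !opprB.
by rewrite mulrCA h mulrBr mulr1 addrC subrK.
Qed.

Variables (S : seq (Zd d)) (K : {fset Zd d}).
Hypothesis uS : uniq S.
Hypothesis thS : forall z, z \notin S -> th z = 0.

Lemma sum_step_law : \sum_(z <- S) th z = 1.
Proof.
have := esum_step_law; rewrite (esum_seq uS) => [|z|z zS].
- by rewrite sumEFin => -[].
- by rewrite lee_fin step_law_ge0.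
- by rewrite thS.
Qed.

Let q := bush_avoid mu theta S K.
Let b := backbone_avoid mu theta S K.

Let subtree (v : seq nat) : set (seq nat) := [set u | prefix v u].

Let subtree_child v i : subtree (rcons v i) `<=` subtree v.
Proof. move=> u; exact/prefix_trans/prefix_rcons. Qed.

Let disjoint_children v j k : j != k ->
  subtree (rcons v j) `&` subtree (rcons v k) = set0.
Proof.
move=> jk; apply/seteqP; split=> // u [/= /prefixP[t ->] /prefixP[t' /eqP]].
rewrite eqseq_cat ?size_rcons// => /andP[/eqP/rcons_inj[jk' _]].
by rewrite jk' eqxx in jk.
Qed.

Let not_subtree_child v i : [set v] `&` subtree (rcons v i) = set0.
Proof.
apply/seteqP; split=> // u [/= -> /size_prefix].
by rewrite size_rcons ltnn.
Qed.

Let bush_event n v x : set Omega :=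
  [set w | bush (N^~ w) (X^~ w) K n v x].

Let backbone_event h n u y : set Omega :=
  [set w | backbone (N^~ w) (C^~ w) (X^~ w) K h n u y].

(** The event reads only labels below v; cutting along the value of [Y v] makes the number of
    children deterministic. *)
Let events_bush n v x : events Y (subtree v) (bush_event n v x).
Proof.
elim: n v x => [|n ih] v x.
  rewrite (_ : bush_event _ _ _ = setT); first exact: eventsT.
  by apply/seteqP; split.
rewrite (_ : bush_event _ _ _ = \bigcup_(y : V)
  ([set w | Y v w = y] `&` (if x + y.2 \in K then set0 else
    [set w | forall i, i \in iota 0 y.1.1 ->
      bush_event n (rcons v i) (x + y.2) w]))).
  apply: events_bigcup => y; apply: eventsI.
    by apply: (@events_val _ _ _ _ Y _ v [set y]); rewrite /subtree/= prefix_refl.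
  case: ifP => _; first exact: events0.
  by apply: events_forall => i _; apply: events_sub (ih _ _); exact: subtree_child.
apply/seteqP; split=> w.
  move=> [/= xK h]; exists (Y v w) => //; split=> //=.
  by rewrite (negbTE xK) => i; rewrite mem_iota/= add0n; exact: h.
move=> [y _ [/= <-]] /=; case: ifPn => // xK h; split=> // i iN.
by apply: h; rewrite mem_iota.
Qed.

Let measurable_bush n v x : measurable (bush_event n v x).
Proof. by apply: (events_measurable mY); exact: events_bush. Qed.

(** Given the step and k children, the subtrees of the children use disjoint sets of labels, so
    their probabilities multiply to a k-th power. The root is excluded because its offspring law is
    shifted. *)
Lemma prob_bush n v x : v != [::] -> P (bush_event n v x) = (q n x)%:E.
Proof.
elim: n v x => [|n ih] v x v0.
  have -> : bush_event 0 v x = setT by apply/seteqP; split.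
  exact: probability_setT.
have q01 y : 0 <= q n y <= 1.
  by rewrite -!lee_fin -(ih [:: 0%N])// measure_ge0 probability_le1.
rewrite (measure_esum_fibers P (mX v))//.
have e z k :
  (P (bush_event n.+1 v x `&` [set w | X v w = z] `&` [set w | N v w = k])
    = (th z * (x + z \notin K)%:R)%:E * (m k * q n (x + z) ^+ k)%:E)%E.
  case: (boolP (x + z \in K)) => xK; rewrite ?mulr0 ?mul0e ?mulr1.
    rewrite (_ : _ `&` _ = set0) ?measure0//.
    by apply/seteqP; split=> // w [[/= [+ _] Xz] _]; rewrite Xz xK.
  rewrite (_ : _ `&` _ = [set w | N v w = k /\ X v w = z] `&`
      [set w | forall i, i \in iota 0 k -> bush_event n (rcons v i) (x + z) w]).
    rewrite (indep_events mY PY (A := [set v])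
       (B := \bigcup_i subtree (rcons v i))); last 3 first.
    - by rewrite setI_bigcupr bigcup0.
    - exact: (@events_val _ _ _ _ Y _ v (fun y : V => y.1.1 = k /\ y.2 = z)).
    - apply: events_forall => i _.
      apply: (events_sub (A := subtree (rcons v i))) => [u|]; first by exists i.
      exact: events_bush.
    rewrite (indep_events_forall mY PY
      (A := fun i => subtree (rcons v i)))//; last 2 first.
    - exact: iota_uniq.
    - exact: disjoint_children.
    have -> : [set w | N v w = k /\ X v w = z] =
      [set w | N v w = k] `&` [set w | X v w = z] by [].
    rewrite prob_children_step// (eq_bigr (fun=> (q n (x + z))%:E)) => [|i _].
      by rewrite prod_cst size_iota -!EFinM [m k * _]mulrC mulrA.
    by rewrite /= ih// -size_eq0 size_rcons.
  apply/seteqP; split=> w /=.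
    move=> [[[_ h] Xz] Nk]; split=> // i; rewrite mem_iota add0n -Nk -Xz.
    exact: h.
  move=> [[Nk Xz] h]; split=> //; split=> //; rewrite Xz; split=> // i.
  by rewrite Nk => ik; apply: h; rewrite mem_iota.
rewrite (eq_esum (b := fun z => (th z * ((x + z \notin K)%:R *
    (1 - (1 - q n (x + z)) * genquot mu (q n (x + z)))))%:E)) => [|z _].
  rewrite (esum_seq uS) ?sumEFin// => [z|z zS]; last by rewrite thS// mul0r.
  rewrite lee_fin !mulr_ge0 ?step_law_ge0// -lee_fin -esum_genfun//.
  apply: esum_ge0 => k _; rewrite lee_fin mulr_ge0 ?offspring_ge0// exprn_ge0//.
  by case/andP: (q01 (x + z)).
rewrite (measure_esum_fibers P (mN v)); last exact: measurableI.
rewrite (eq_esum (fun k _ => e z k)) esumZl => [|k|]; last 2 first.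
- rewrite lee_fin mulr_ge0 ?offspring_ge0// exprn_ge0//.
  by case/andP: (q01 (x + z)).
- by rewrite mulr_ge0 ?step_law_ge0.
by rewrite esum_genfun// -EFinM mulrA.
Qed.

Lemma bush_avoid_ge0_le1 n x : 0 <= q n x <= 1.
Proof.
by rewrite -!lee_fin -(@prob_bush n [:: 0%N])// measure_ge0 probability_le1.
Qed.

Let events_backbone h n u y : events Y (subtree u) (backbone_event h n u y).
Proof.
elim: h n u y => [|h ih] n u y.
  rewrite (_ : backbone_event _ _ _ _ = setT); first exact: eventsT.
  by apply/seteqP; split.
rewrite (_ : backbone_event _ _ _ _ = \bigcup_(t : V)
  ([set w | Y u w = t] `&` (if y - t.2 \in K then set0 else
    [set w | forall i, i \in iota t.1.2.2.+1 (t.1.2.1 - t.1.2.2.+1) ->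
       bush_event n (rcons u i) (y - t.2) w] `&`
    backbone_event h n.+1 (rcons u t.1.2.2) (y - t.2)))).
  apply: events_bigcup => t; apply: eventsI.
    by apply: (@events_val _ _ _ _ Y _ u [set t]); rewrite /subtree/= prefix_refl.
  case: ifP => _; first exact: events0.
  apply: eventsI.
    apply: events_forall => i _; apply: (events_sub (A := subtree (rcons u i))).
      exact: subtree_child.
    exact: events_bush.
  apply: (events_sub (A := subtree (rcons u t.1.2.2))); first exact: subtree_child.
  exact: ih.
have iota_ltn (c : nat * nat) i :
    (i \in iota c.2.+1 (c.1 - c.2.+1)) = (c.2 < i)%N && (i < c.1)%N.
  rewrite mem_iota; case: ltnP => //= c2i; case: (leqP c.2.+1 c.1) => c21.
    by rewrite subnKC.
  move: (c21); rewrite -subn_eq0 => /ltnW; rewrite -subn_eq0 => /eqP ->.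
  rewrite addn0 ltnNge c2i/=; apply/esym/negbTE; rewrite -leqNgt.
  exact: leq_trans (ltnW c21) c2i.
apply/seteqP; split=> w.
  move=> [/= xK h1 h2]; exists (Y u w) => //; split=> //=.
  by rewrite (negbTE xK); split=> // i; rewrite iota_ltn => /andP[]; exact: h1.
move=> [t _ [/= <-]] /=; case: ifPn => // xK [h1 h2]; split=> // i i1 i2.
by apply: h1; rewrite iota_ltn i1.
Qed.

Let measurable_backbone h n u y : measurable (backbone_event h n u y).
Proof. by apply: (events_measurable mY); exact: events_backbone. Qed.

Let measurable_val v (Q : set V) : measurable [set w | Q (Y v w)].
Proof.
apply: (events_measurable mY).
exact: (@events_val _ _ _ _ Y [set v] v Q).
Qed.

Let mC1 v k : measurable [set w | (C v w).1 = k].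
Proof. exact: (measurable_val v (fun y : V => y.1.2.1 = k)). Qed.

Let mC2 v k : measurable [set w | (C v w).2 = k].
Proof. exact: (measurable_val v (fun y : V => y.1.2.2 = k)). Qed.

(** Given the step, k children and rank j, child j continues the spine and the k - j - 1 later ones
    start independent bushes. *)
Lemma prob_backbone h n u y : u != [::] ->
  P (backbone_event h n u y) = (b h n y)%:E.
Proof.
elim: h n u y => [|h ih] n u y u0.
  have -> : backbone_event 0 n u y = setT by apply/seteqP; split.
  exact: probability_setT.
have b01 n' x : 0 <= b h n' x <= 1.
  by rewrite -!lee_fin -(ih n' [:: 0%N])// measure_ge0 probability_le1.
rewrite (measure_esum_fibers P (mX u))//.
have e z k j : (P (backbone_event h.+1 n u y `&` [set w | X u w = z] `&`
       [set w | (C u w).1 = k] `&` [set w | (C u w).2 = j])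
    = (th z * (y - z \notin K)%:R * b h n.+1 (y - z))%:E *
      (s (k, j) * q n (y - z) ^+ (k - j.+1))%:E)%E.
  case: (boolP (y - z \in K)) => xK; rewrite ?mulr0 ?mul0r ?mul0e ?mulr1.
    rewrite (_ : _ `&` _ = set0) ?measure0//.
    by apply/seteqP; split=> // w [[[/= [+ _ _] Xz] _] _]; rewrite Xz xK.
  (* A rank that is not below k has probability 0, in agreement with the vanishing of [s]. *)
  have [jk|kj] := ltnP j k; last first.
    rewrite /s/= ltnNge kj/= mul0r mule0.
    apply/eqP; rewrite -measure_le0.
    apply: le_trans
      (_ : (P ([set w | C u w = (k, j)] `&` [set w | X u w = z]) <= 0)%E).
      apply: le_measure; rewrite ?inE.
      - apply: measurableI; last exact: mC2.
        by apply: measurableI; [exact: measurableI|exact: mC1].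
      - exact: measurableI.
      - by move=> w [[[_ /= ->] C1] C2]; split=> //=; rewrite -C1 -C2; case: (C u w).
    by rewrite prob_special_step// /s/= ltnNge kj/= mul0r.
  (* Children of rank below j do not belong to the past, so only the ranks from j on are listed. *)
  pose E i := if i == j then backbone_event h n.+1 (rcons u j) (y - z)
              else bush_event n (rcons u i) (y - z).
  have EE i : events Y (subtree (rcons u i)) (E i).
    by rewrite /E; case: eqP => [->|_]; [exact: events_backbone|exact: events_bush].
  rewrite (_ : _ `&` _ = [set w | C u w = (k, j) /\ X u w = z] `&`
      [set w | forall i, i \in iota j (k - j) -> E i w]).
    rewrite (indep_events mY PY (A := [set u])
       (B := \bigcup_i subtree (rcons u i))); last 3 first.
    - by rewrite setI_bigcupr bigcup0.
    - exact: (@events_val _ _ _ _ Y _ u (fun y : V => y.1.2 = (k, j) /\ y.2 = z)).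
    - apply: events_forall => i _.
      by apply: (events_sub (A := subtree (rcons u i))) => [v|//]; exists i.
    rewrite (indep_events_forall mY PY
      (A := fun i => subtree (rcons u i)))//; last 2 first.
    - exact: iota_uniq.
    - exact: disjoint_children.
    have -> : [set w | C u w = (k, j) /\ X u w = z] =
      [set w | C u w = (k, j)] `&` [set w | X u w = z] by [].
    rewrite prob_special_step//.
    rewrite -(subnSK jk)/= big_cons {1}/E eqxx ih -?size_eq0 ?size_rcons//.
    rewrite big_seq (eq_bigr (fun=> (q n (y - z))%:E)) => [|i]; last first.
      rewrite mem_iota => /andP[ji _].
      by rewrite /E gtn_eqF// prob_bush// -size_eq0 size_rcons.
    rewrite -big_seq prod_cst size_iota -!EFinM; congr EFin.
    rewrite subnS; ring.
  apply/seteqP; split=> w /=.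
    move=> [[[[_ h1 h2] Xz] C1] C2].
    have CE : C u w = (k, j) by rewrite -C1 -C2; case: (C u w).
    split=> // i; rewrite mem_iota subnKC ?(ltnW jk)// => /andP[ji ik].
    rewrite /E; case: eqVneq => [_|ij]; rewrite -Xz; first by move: h2; rewrite CE.
    by apply: h1; rewrite CE// ltn_neqAle eq_sym ij.
  move=> [[CE Xz] hE]; rewrite CE; split=> //; split=> //; split=> //; split.
  - by rewrite Xz.
  - rewrite /= => i ji ik; have := hE i.
    by rewrite mem_iota subnKC ?(ltnW jk)// ltnW// ik /E gtn_eqF// Xz => /(_ isT).
  - have := hE j; rewrite mem_iota subnKC ?(ltnW jk)// leqnn jk /E eqxx /= Xz.
    by move=> /(_ isT).
rewrite (eq_esum (b := fun z => (th z * ((y - z \notin K)%:R *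
    (genquot mu (q n (y - z)) * b h n.+1 (y - z))))%:E)) => [|z _].
  rewrite (esum_seq uS) ?sumEFin// => [z|z zS]; last by rewrite thS// mul0r.
  rewrite lee_fin !mulr_ge0 ?step_law_ge0 ?genquot_ge0//.
    by case/andP: (bush_avoid_ge0_le1 n (y - z)).
  by case/andP: (b01 n.+1 (y - z)).
have mE : measurable (backbone_event h.+1 n u y `&` [set w | X u w = z]).
  exact: measurableI.
rewrite (measure_esum_fibers P (mC1 u))//.
have /andP[q0 q1] := bush_avoid_ge0_le1 n (y - z).
transitivity (\esum_(k in [set: nat])
  ((th z * (y - z \notin K)%:R * b h n.+1 (y - z))%:E *
   (m k * \sum_(j < k) q n (y - z) ^+ j)%:E)%E)%E.
  apply: eq_esum => k _.
  rewrite (measure_esum_fibers P (mC2 u)); last by apply: measurableI => //; exact: mC1.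
  rewrite (eq_esum (fun j _ => e z k j)) esumZl => [|j|].
  - rewrite esum_rank => [|j]; last by rewrite exprn_ge0.
    (* Reversing the ranks turns the exponents k - j - 1 into j. *)
    by congr (_ * (_ * _)%:E)%E; rewrite [RHS](reindex_inj rev_ord_inj).
  - by rewrite lee_fin mulr_ge0 ?exprn_ge0.
  - by rewrite !mulr_ge0 ?step_law_ge0//; case/andP: (b01 n.+1 (y - z)).
rewrite esumZl => [|k|].
- rewrite genquotE ?q0// -EFinM; congr EFin; ring.
- exact: genquot_term_ge0.
- by rewrite !mulr_ge0 ?step_law_ge0//; case/andP: (b01 n.+1 (y - z)).
Qed.

Lemma measurable_backbone_root h n y : measurable
  [set w | backbone (N^~ w) (C^~ w) (X^~ w) K h n [:: (N [::] w).-1] y].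
Proof.
rewrite (_ : [set _ | _] = \bigcup_k ([set w | N [::] w = k] `&`
    backbone_event h n [:: k.-1] y)).
  by apply: bigcup_measurable => k _; exact: measurableI.
apply/seteqP; split=> w /=; first by move=> hw; exists (N [::] w).
by move=> [k _ [/= ->]].
Qed.

Lemma prob_backbone_root h n y :
  P [set w | backbone (N^~ w) (C^~ w) (X^~ w) K h n [:: (N [::] w).-1] y] =
  (b h n y)%:E.
Proof.
rewrite (measure_esum_fibers P (mN [::])); last exact: measurable_backbone_root.
transitivity (\esum_(k in [set: nat])
    ((b h n y)%:E * P [set w | N [::] w = k])%E)%E.
  apply: eq_esum => k _; rewrite -(@prob_backbone h n [:: k.-1])//.
  rewrite muleC -(indep_events mY PY (A := [set [::]])
    (B := subtree (rcons [::] k.-1)) (E := [set w | N [::] w = k])).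
  - congr (P _); apply/seteqP; split=> w /=; first by move=> [+ kw]; rewrite kw.
    by move=> [-> ?].
  - exact: not_subtree_child.
  - exact: (@events_val _ _ _ _ Y _ [::] (fun y : V => y.1.1 = k)).
  - exact: events_backbone.
have b_ge0 : 0 <= b h n y.
  by rewrite -lee_fin -(@prob_backbone h n [:: 0%N]).
rewrite esumZl//.
have -> : (\esum_(k in [set: nat]) P [set w | N [::] w = k] = 1)%E.
  rewrite -(@probability_setT _ _ _ P) (measure_esum_fibers P (mN [::]))//.
  by apply: eq_esum => k _; rewrite setTI.
by rewrite mule1.
Qed.

Lemma prob_val_null v (Q : set V) : (forall t, Q t -> p v t = 0%E) ->
  P [set w | Q (Y v w)] = 0%E.
Proof.
move=> Q0; rewrite (measure_esum_fibers P (mY v)); last exact: (measurable_val v Q).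
apply: esum1 => t _; have [Qt|nQt] := pselect (Q t).
  apply/eqP; rewrite -measure_le0 -(Q0 t Qt) -(prob_val PY).
  apply: le_measure => [||w []//]; rewrite inE; last exact: mY.
  by apply: measurableI; [exact: (measurable_val v Q)|exact: mY].
rewrite (_ : _ `&` _ = set0) ?measure0//.
by apply/seteqP; split=> // w /= [+ tw]; rewrite tw.
Qed.

Lemma prob_root_childless : P [set w | N [::] w = 0%N] = 0%E.
Proof.
apply: (@prob_val_null [::] (fun t => t.1.1 = 0%N)) => t t0.
by rewrite /p t0 /children_law/= !mul0e.
Qed.

Lemma prob_special_rank v : P [set w | ((C v w).1 <= (C v w).2)%N] = 0%E.
Proof.
apply: (@prob_val_null v (fun t => (t.1.2.1 <= t.1.2.2)%N)) => t t0.
by rewrite /p /special_law ltnNge t0/= mule0 mul0e.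
Qed.

Lemma le_backbone_avoid h h' n n' y : (h <= h')%N -> (n <= n')%N ->
  b h' n' y <= b h n y.
Proof.
move=> hh' nn'; rewrite -lee_fin -!(@prob_backbone _ _ [:: 0%N])//.
apply: le_measure; rewrite ?inE//.
by move=> w; exact: backbone_mono.
Qed.

Lemma backbone_avoid_ge0_le1 h n y : 0 <= b h n y <= 1.
Proof.
by rewrite -!lee_fin -(@prob_backbone h n [:: 0%N])// measure_ge0 probability_le1.
Qed.

End walk_laws.

(** * Decomposition at the first vertex in K *)

Section duality.
Context {R : realType} {d : nat} (mu : probability nat R)
  (theta : probability (Zd d) R) (S : seq (Zd d)) (K : {fset Zd d}).

Let th := step_law theta.
Let q := bush_avoid mu theta S K.
Let b := backbone_avoid mu theta S K.
Let G := genquot mu.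

Let th0 z : 0 <= th z. Proof. exact: step_law_ge0. Qed.

Hypothesis sum_th : \sum_(z <- S) th z = 1.
Hypothesis q01 : forall n x, 0 <= q n x <= 1.
Hypothesis b0 : forall h n y, 0 <= b h n y.

(* The probability that the first n generations of the critical tree rooted at x
   hit K. *)
Definition hit (n : nat) (x : Zd d) : R :=
  if n is n'.+1 then
    (x \in K)%:R + (x \notin K)%:R * ((1 - q n' x) * G (q n' x))
  else 0.

Lemma hit_ge0 n x : 0 <= hit n x.
Proof.
case: n => //= n; have /andP[q0 q1] := q01 n x.
by rewrite addr_ge0// !mulr_ge0// ?subr_ge0// genquot_ge0.
Qed.

(** A bush is a critical tree whose first vertex lies one step away from x. *)
Lemma bush_hit n x : 1 - q n x = \sum_(z <- S) th z * hit n (x + z).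
Proof.
rewrite -[X in X - _]sum_th; case: n => [|n] /=.
  by rewrite [RHS]big1 => [|z _]; rewrite ?mulr0// /q/= sum_th subrr.
rewrite -sumrB; apply: eq_bigr => z _; rewrite -/th -/(q n (x + z)) -/G.
by case: (x + z \in K) => /=; ring.
Qed.

(** A tree that hits K has its root in K or has a first child whose subtree hits K; [genquot] weighs
    the earlier siblings, which avoid K. Taking that child as new origin turns the old root into one
    more backbone vertex. *)
Lemma esum_hit_step h n :
  (\esum_(x in [set: Zd d]) (hit n.+1 x * b h n.+1 x)%:E =
   (\sum_(y <- K) b h n.+1 y)%:E +
   \esum_(x in [set: Zd d]) (hit n x * b h.+1 n x)%:E)%E.
Proof.
(* The contribution of the old root: its position off K, its avoiding children, and the backbone
   beyond it. *)
pose w x := (x \notin K)%:R * (G (q n x) * b h n.+1 x).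
have w0 x : 0 <= w x.
  by have /andP[q0 _] := q01 n x; rewrite !mulr_ge0// genquot_ge0.
transitivity (\esum_(x in [set: Zd d]) (((x \in K)%:R * b h n.+1 x)%:E +
    \sum_(z <- S) (th z * (hit n (x + z) * w x))%:E)%E)%E.
  apply: eq_esum => x _; rewrite sumEFin -EFinD; congr EFin.
  under eq_bigr do rewrite mulrA.
  by rewrite -mulr_suml -bush_hit /w /=; ring.
rewrite esumD => [|x _|x _]; last 2 first.
- by rewrite lee_fin mulr_ge0.
- by apply: sume_ge0 => z _; rewrite lee_fin mulr_ge0 ?th0// mulr_ge0 ?hit_ge0.
congr (_ + _)%E.
  rewrite (esum_seq (fset_uniq K)); last 2 first.
  - by move=> x; rewrite lee_fin mulr_ge0.
  - by move=> x xK; rewrite (negbTE xK) mul0r.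
  rewrite sumEFin; congr EFin; rewrite big_seq [RHS]big_seq.
  by apply: eq_bigr => y ->; rewrite mul1r.
rewrite esum_sum => [|x z _ _]; last first.
  by rewrite lee_fin mulr_ge0 ?th0// mulr_ge0 ?hit_ge0.
(* For each step z, the sum over the whole lattice is translated to the position of the child. *)
transitivity (\sum_(z <- S) \esum_(x in [set: Zd d])
  (th z * (hit n x * w (x - z)))%:E)%E.
  apply: eq_bigr => z _.
  rewrite (@reindex_esum _ _ _ setT setT (fun x => x - z)).
    by apply: eq_esum => x _; rewrite subrK.
  split=> //; first by move=> x y _ _ /addIr.
  by move=> x _; exists (x + z) => //; rewrite addrK.
rewrite -esum_sum => [|x z _ _]; last first.
  by rewrite lee_fin mulr_ge0 ?th0// mulr_ge0 ?hit_ge0.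
apply: eq_esum => x _; rewrite sumEFin; congr EFin.
rewrite [in RHS]/b /= mulr_sumr; apply: eq_bigr => z _.
by rewrite mulrCA.
Qed.

(** Each use of the one-step identity trades a generation for a spine vertex, until [hit] vanishes
    at 0 generations. *)
Lemma esum_hit_backbone h n :
  (\esum_(x in [set: Zd d]) (hit n x * b h n x)%:E =
   (\sum_(i < n) \sum_(y <- K) b (h + i) (n - i) y)%:E)%E.
Proof.
elim: n h => [|n ih] h.
  by rewrite big_ord0 esum1// => x _; rewrite mul0r.
rewrite esum_hit_step ih -EFinD big_ord_recl/= addn0 subn0; congr (_ + _)%:E.
by apply: eq_bigr => i _; rewrite /bump/= addnS.
Qed.

Lemma esum_hit n :
  (\esum_(x in [set: Zd d]) (hit n x)%:E =
   (\sum_(i < n) \sum_(y <- K) b i (n - i) y)%:E)%E.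
Proof.
rewrite -(esum_hit_backbone 0); apply: eq_esum => x _.
by rewrite mulr1.
Qed.

Lemma sum_hit_enum_cvg n :
  \sum_(x <- enum_upto M) hit n x @[M --> \oo] -->
  \sum_(i < n) \sum_(y <- K) b i (n - i) y.
Proof.
have := esum_hit n; rewrite esum_nneseries => [h|x]; last first.
  by rewrite lee_fin hit_ge0.
have cv : (\sum_(0 <= i < M)
      oapp (fun x => (hit n x)%:E) 0 (@choice.pickle_inv (Zd d) i)
    @[M --> \oo] --> (\sum_(i < n) \sum_(y <- K) b i (n - i) y)%:E)%E.
  rewrite -h; apply: is_cvg_nneseries => i _ _.
  by case: (choice.pickle_inv i) => //= x; rewrite lee_fin hit_ge0.
rewrite (_ : (fun M => _) = fine \o (fun M => \sum_(0 <= i < M)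
    oapp (fun x => (hit n x)%:E) 0 (@choice.pickle_inv (Zd d) i))%E).
  exact: fine_cvg cv.
apply/funext => M /=; rewrite /enum_upto big_pmap /index_iota subn0.
rewrite (eq_bigr (fun i => (oapp (hit n) 0 (@choice.pickle_inv (Zd d) i))%:E)).
  by rewrite sumEFin.
by move=> i _; case: (choice.pickle_inv i).
Qed.

End duality.

(** * Complete monotonicity of the truncated sums *)

Section complete_monotonicity.
Context {R : realType} {d : nat} (mu : probability nat R)
  (theta : probability (Zd d) R) (S : seq (Zd d)).

Let q K := bush_avoid mu theta S K.

Hypothesis genfunE : forall a : R, 0 <= a <= 1 ->
  (\esum_(k in [set: nat]) (offspring mu k * a ^+ k)%:E =
   (1 - (1 - a) * genquot mu a)%:E)%E.
Hypothesis q01 : forall K n x, 0 <= q K n x <= 1.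

Lemma genfun_cvg (a : R) : 0 <= a <= 1 ->
  \sum_(k <- iota 0 M) offspring mu k * a ^+ k @[M --> \oo] -->
  1 - (1 - a) * genquot mu a.
Proof.
move=> a01; have := genfunE a01; have /andP[a0 _] := a01.
have t0 k : (0 <= (offspring mu k * a ^+ k)%:E)%E.
  by rewrite lee_fin mulr_ge0 ?offspring_ge0 ?exprn_ge0.
rewrite -nneseries_esumT// => h.
have cv : (\sum_(0 <= k < M) (offspring mu k * a ^+ k)%:E @[M --> \oo] -->
    (1 - (1 - a) * genquot mu a)%:E)%E.
  by rewrite -h; apply: is_cvg_nneseries.
rewrite (_ : (fun M => _) = fine \o
    (fun M => \sum_(0 <= k < M) (offspring mu k * a ^+ k)%:E)%E).
  exact: fine_cvg cv.
by apply/funext => M /=; rewrite sumEFin /index_iota subn0.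
Qed.

(** The generating function is a limit of polynomials with nonnegative coefficients. *)
Lemma cmon_genfun (f : {fset Zd d} -> R) : (forall K, 0 <= f K <= 1) ->
  cmon f -> cmon (fun K => 1 - (1 - f K) * genquot mu (f K)).
Proof.
move=> f01 fc.
apply: (@cmon_lim _ _ (fun M K => \sum_(k <- iota 0 M) offspring mu k * f K ^+ k)).
  move=> M; apply: cmon_sum => k; apply: cmonM; last exact: cmonX.
  by apply: cmon_cst; exact: offspring_ge0.
by move=> K; exact: genfun_cvg.
Qed.

Lemma cmon_bush_avoid n x : cmon (fun K => q K n x).
Proof.
elim: n x => [|n ih] x; first exact: cmon_cst.
apply: (@cmon_sum _ _ _ S (fun z K => _)) => z.
apply: cmonM; first by apply: cmon_cst; exact: step_law_ge0.
apply: cmonM; first exact: cmon_notin.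
by apply: cmon_genfun; [move=> K; exact: q01|exact: ih].
Qed.

Lemma cmon_not_hit n x : cmon (fun K => 1 - hit mu theta S K n x).
Proof.
case: n => [|n] /=; first by under eq_fun do rewrite subr0; exact: cmon_cst.
rewrite (_ : (fun K => _) = fun K => (x \notin K)%:R *
    (1 - (1 - q K n x) * genquot mu (q K n x))).
  apply: cmonM; first exact: cmon_notin.
  by apply: cmon_genfun; [move=> K; exact: q01|exact: cmon_bush_avoid].
apply/funext => K; rewrite -/(q K n x).
by case: (x \in K) => /=; ring.
Qed.

(** Each factor exp(- t hit) equals exp(- t) exp(t (1 - hit)), where 1 - hit is completely
    monotone. *)
Lemma cmon_expR_hit (t : R) n (s : seq (Zd d)) : 0 <= t ->
  cmon (fun K => expR (- (t * \sum_(x <- s) hit mu theta S K n x))).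
Proof.
move=> t0; rewrite (_ : (fun K => _) =
  fun K => \prod_(x <- s) (expR (- t) * expR (t * (1 - hit mu theta S K n x)))).
  apply: cmon_prod => x; apply: cmonM; first by apply: cmon_cst; exact: expR_ge0.
  apply: cmon_expR; apply: cmonM; first exact: cmon_cst.
  exact: cmon_not_hit.
apply/funext => K; rewrite mulr_sumr -sumrN expR_sum.
by apply: eq_bigr => x _; rewrite -expRD; congr expR; ring.
Qed.

Hypothesis sum_th : \sum_(z <- S) step_law theta z = 1.
Hypothesis b0 : forall K h n y, 0 <= backbone_avoid mu theta S K h n y.

Lemma cmon_expR_backbone (t : R) n : 0 <= t ->
  cmon (fun K => expR (- (t *
    \sum_(i < n) \sum_(y <- K) backbone_avoid mu theta S K i (n - i) y))).
Proof.
move=> t0; apply: (@cmon_lim _ _ (fun M K =>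
    expR (- (t * \sum_(x <- enum_upto M) hit mu theta S K n x)))) => [M|K].
  exact: cmon_expR_hit.
have h := @sum_hit_enum_cvg _ _ mu theta S K sum_th (q01 K) (b0 K) n.
have {}h : - (t * \sum_(x <- enum_upto M) hit mu theta S K n x) @[M --> \oo] -->
    - (t * \sum_(i < n) \sum_(y <- K) backbone_avoid mu theta S K i (n - i) y).
  by apply: cvgN; apply: cvgMl_tmp.
by apply: cvg_comp h _; exact: continuous_expR.
Qed.

End complete_monotonicity.

(** * The past of the root *)

Section valid_labels.
Implicit Types (f : seq nat -> nat) (v t : seq nat).

(** With f arbitrary, the tree below a vertex is again of this form for a shifted f. *)
Definition valid f v := forall u i, prefix (rcons u i) v -> (i < f u)%N.

Lemma valid_nil f : valid f [::].
Proof. by move=> [|a u] i. Qed.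

Lemma valid_cons f j t : valid f (j :: t) <->
  (j < f [::])%N /\ valid (fun s => f (j :: s)) t.
Proof.
split=> [h|[h0 h] [|a u] i].
- split=> [|u i ut]; first by apply: (h [::]); rewrite prefix_cons eqxx prefix0s.
  by apply: (h (j :: u)); rewrite prefix_cons eqxx.
- by rewrite prefix_cons => /andP[/eqP -> _].
- by rewrite rcons_cons prefix_cons => /andP[/eqP ->]; exact: h.
Qed.

Lemma valid_cat f v t : valid f (v ++ t) <->
  valid f v /\ valid (fun s => f (v ++ s)) t.
Proof.
elim: v f => [|j v ih] f /=.
  split=> [h|[_ h]] //; split=> //; exact: valid_nil.
rewrite !valid_cons; split=> [[h0 /ih[]]|[[h0 h1] h2]] //.
by split=> //; apply/ih.
Qed.

Lemma valid_rcons f v i : valid f (rcons v i) <-> valid f v /\ (i < f v)%N.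
Proof.
rewrite -cats1 valid_cat valid_cons cats0.
by split=> [[h1 [h2 _]]|[h1 h2]]; split=> //; split=> //; exact: valid_nil.
Qed.

Lemma eq_valid f g t : f =1 g -> valid f t -> valid g t.
Proof. by move=> /funext ->. Qed.

End valid_labels.

Section past_avoidance.
Context {V : zmodType}.
Variables (N : seq nat -> nat) (C : seq nat -> nat * nat) (X : seq nat -> V).
Variables (K : {fset V}) (y : V).

Local Notation spine := (spine N C).
Local Notation special := (special N C).
Local Notation walk := (walk N C X y).

Lemma spineS n : exists i, spine n.+1 = rcons (spine n) i.
Proof. by case: n => [|n]; [exists (N [::]).-1|exists (C (spine n.+1)).2]. Qed.

Lemma spineSS n : spine n.+2 = rcons (spine n.+1) (C (spine n.+1)).2.
Proof. by []. Qed.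

Lemma size_spine n : size (spine n) = n.
Proof.
by elim: n => // n ih; have [i ->] := spineS n; rewrite size_rcons ih.
Qed.

Lemma take_spine m n : (m <= n)%N -> take m (spine n) = spine m.
Proof.
elim: n => [|n ih]; first by rewrite leqn0 => /eqP ->.
rewrite leq_eqVlt => /orP[/eqP ->|mn]; first by rewrite -{1}[n.+1]size_spine take_size.
have [i ->] := spineS n; rewrite -cats1 takel_cat ?size_spine//.
exact: ih.
Qed.

Lemma special_spine n : special (spine n.+1).
Proof.
rewrite /special size_spine eqxx andbT.
by have [i ->] := spineS n; rewrite -size_eq0 size_rcons.
Qed.

(** Prefixes of a special label lie on the spine, so the prefix of length n + 2 would have to end
    with the rank of the special child. *)
Lemma not_special n i t : i != (C (spine n.+1)).2 ->
  ~~ special (rcons (spine n.+1) i ++ t).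
Proof.
move=> iC; rewrite /special negb_and; apply/orP; right; apply/negP => /eqP e.
have : take n.+2 (rcons (spine n.+1) i ++ t) = spine n.+2.
  by rewrite e take_spine// size_cat size_rcons size_spine leq_addr.
have sz : size (rcons (spine n.+1) i) = n.+2 by rewrite size_rcons size_spine.
rewrite -sz take_size_cat// sz spineSS => /rcons_inj[] /eqP.
by rewrite (negbTE iC).
Qed.

Lemma walk_rcons v i : walk (rcons v i) = walk v +
  (if special (rcons v i) then - X (rcons v i) else X (rcons v i)).
Proof.
rewrite /Defs.walk size_rcons big_nat_recr//= addrA; congr (_ + _ + _).
  apply: eq_big_nat => m /andP[m0 mv].
  by rewrite -cats1 takel_cat.
by rewrite take_oversize// size_rcons.
Qed.

Lemma walk_spineS n : walk (spine n) - X (spine n.+1) = walk (spine n.+1).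
Proof.
have := special_spine n; have [i ->] := spineS n => sp.
by rewrite walk_rcons sp.
Qed.

(** With no special label at or below the vertex, all steps point forward and [N] alone decides
    which labels are vertices. *)
Lemma bushP n v i : (forall t, ~~ special (rcons v i ++ t)) ->
  bush N X K n (rcons v i) (walk v) <->
  (forall t, (size t < n)%N -> valid (fun s => N (rcons v i ++ s)) t ->
    walk (rcons v i ++ t) \notin K).
Proof.
elim: n v i => [|n ih] v i ns; first by split.
have wE : walk v + X (rcons v i) = walk (rcons v i).
  by rewrite walk_rcons; have := ns [::]; rewrite cats0 => /negbTE ->.
have nsj j t : ~~ special (rcons (rcons v i) j ++ t) by rewrite cat_rcons ns.
rewrite [bush _ _ _ _ _ _]/= wE; split=> [[h0 h] [|j t]|h].
- by rewrite cats0.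
- rewrite ltnS => tn /valid_cons[]; rewrite cats0 => jN tv.
  rewrite -cat_rcons; apply: (iffLR (ih _ _ (nsj j))) => //; first exact: h.
  by apply: eq_valid tv => s; rewrite !cat_rcons.
- split; first by have := h [::]; rewrite cats0; apply => //; exact: valid_nil.
  move=> j jN; apply/(ih _ _ (nsj j)) => t tn tv.
  rewrite cat_rcons; apply: h => //; apply/valid_cons; rewrite cats0; split=> //.
  by apply: eq_valid tv => s; rewrite !cat_rcons.
Qed.

Lemma backboneP h n m :
  backbone N C X K h n (spine m.+1) (walk (spine m)) <->
  (forall k, (k < h)%N -> walk (spine (m + k).+1) \notin K /\
    forall i, ((C (spine (m + k).+1)).2 < i)%N ->
      (i < (C (spine (m + k).+1)).1)%N ->
      bush N X K (n + k) (rcons (spine (m + k).+1) i)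
        (walk (spine (m + k).+1))).
Proof.
elim: h n m => [|h ih] n m; first by split.
rewrite [backbone _ _ _ _ _ _ _ _]/= walk_spineS.
have -> : rcons (spine m.+1) (C (spine m.+1)).2 = spine m.+2 by [].
split=> [[h1 h2 /ih h3] [_|k kh]|hk].
- by rewrite !addn0.
- by rewrite !addnS -!addSn; exact: h3.
- have [] := hk 0%N isT; rewrite !addn0 => h1 h2; split=> //.
  by apply/ih => k kh; have := hk k.+1 kh; rewrite !addnS -!addSn.
Qed.

Hypothesis N0 : (0 < N [::])%N.
Hypothesis CC : forall v, ((C v).2 < (C v).1)%N.

Local Notation nb := (nb_children N C).

Lemma vertices_spine n : vertices N C (spine n).
Proof.
elim: n => [|[|n] ih]; first exact: valid_nil.
  apply/(valid_rcons _ [::]); split; first exact: valid_nil.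
  by rewrite /nb_children/= prednK.
apply/valid_rcons; split=> //.
by rewrite /nb_children special_spine.
Qed.

Lemma nb_bush n i t : i != (C (spine n.+1)).2 ->
  nb (rcons (spine n.+1) i ++ t) = N (rcons (spine n.+1) i ++ t).
Proof. by move=> /not_special => /(_ t) ns; rewrite /nb_children (negbTE ns). Qed.

(** Truncating both the spine and the bushes at h loses nothing, since each vertex of the past is
    reached for h large. *)
Lemma past_avoidsP :
  (forall v, past N C v -> walk v \notin K) <->
  (forall h, backbone N C X K h h [:: (N [::]).-1] y).
Proof.
have y0 : walk (spine 0) = y by rewrite /Defs.walk big_nil addr0.
rewrite -{2}y0; split=> [hp h|hb v [vv [[//|n] _ [->|[i iC /prefixP[t vE]]]]]].
- apply/(backboneP h h 0) => k _; rewrite add0n; split.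
    by apply: hp; split; [exact: vertices_spine|exists k.+1 => //; left].
  move=> i iC iC'.
  have iC2 : i != (C (spine k.+1)).2 by rewrite gtn_eqF.
  apply/bushP => [t|t _ tv]; first exact: not_special.
  apply: hp; split; last first.
    by exists k.+1 => //; right; exists i => //; exact: prefix_prefix.
  apply/valid_cat; split.
    apply/valid_rcons; split; first exact: vertices_spine.
    by rewrite /nb_children special_spine.
  by apply: eq_valid tv => s; rewrite nb_bush.
- have /(backboneP _ _ 0)/(_ n (ltnSn n))[] := hb n.+1.
  by rewrite add0n.
- have iC2 : i != (C (spine n.+1)).2 by rewrite gtn_eqF.
  move: vv; rewrite vE => /valid_cat[/valid_rcons[_ iN] tv].
  have {}iN : (i < (C (spine n.+1)).1)%N.
    by move: iN; rewrite /nb_children special_spine.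
  (* More than n spine vertices and more than [size t] generations are needed; h = n + size t + 1
     provides both. *)
  have nh : (n < (n + size t).+1)%N by rewrite ltnS leq_addr.
  have /(backboneP _ _ 0)/(_ n nh)[_] := hb (n + size t).+1.
  rewrite add0n => /(_ i iC iN) /bushP; apply.
  + by move=> t'; exact: not_special.
  + by rewrite ltn_addr// ltnS leq_addl.
  + by apply: eq_valid tv => s; rewrite nb_bush.
Qed.

End past_avoidance.

(** * Measurability of the avoidance event *)

Section discrete_measurability.
Context {d : measure_display} {Omega : measurableType d}.

(** All preimages are required to be measurable, which suits random labels without a choice of
    sigma-algebra on them. *)
Definition dmeasurable {T : Type} (f : Omega -> T) : Prop :=
  forall Q : set T, measurable [set w | Q (f w)].

Lemma dmeasurable_fibers (T : countType) (f : Omega -> T) :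
  (forall t, measurable [set w | f w = t]) -> dmeasurable f.
Proof.
move=> mf Q; rewrite (_ : [set _ | _] =
  \bigcup_t (if t \in Q then [set w | f w = t] else set0)).
  apply: countable_bigcupT_measurable => // t.
  by case: ifP.
apply/seteqP; split=> w /=.
  by move=> Qw; exists (f w) => //; rewrite mem_set.
by move=> [y _]; case: ifPn => // /set_mem Qy /= ->.
Qed.

Lemma dmeasurable_cst (T : Type) (t : T) : dmeasurable (fun=> t).
Proof.
move=> Q; have [Qt|nQt] := pselect (Q t).
  by rewrite (_ : [set _ | _] = setT)//; apply/seteqP; split.
by rewrite (_ : [set _ | _] = set0)//; apply/seteqP; split.
Qed.

(** Meant for variables read at a random label, such as [C] at a spine vertex: the event is cut
    along the countably many labels. *)
Lemma dmeasurable_bind (T : countType) (U : Type) (f : Omega -> T)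
    (g : T -> Omega -> U) :
  dmeasurable f -> (forall t, dmeasurable (g t)) ->
  dmeasurable (fun w => g (f w) w).
Proof.
move=> mf mg Q; rewrite (_ : [set _ | _] =
  \bigcup_t ([set w | f w = t] `&` [set w | Q (g t w)])).
  apply: countable_bigcupT_measurable => // t.
  by apply: measurableI; [exact: (mf (fun t' => t' = t))|exact: (mg t Q)].
apply/seteqP; split=> w /=; first by move=> Qw; exists (f w).
by move=> [t _ [/= ->]].
Qed.

Lemma dmeasurable_comp (T U : Type) (f : Omega -> T) (g : T -> U) :
  dmeasurable f -> dmeasurable (g \o f).
Proof. by move=> mf Q; exact: (mf (g @^-1` Q)). Qed.

Lemma measurable_forall (T : countType) (E : T -> set Omega) :
  (forall t, measurable (E t)) -> measurable [set w | forall t, E t w].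
Proof.
move=> mE; rewrite (_ : [set _ | _] = ~` \bigcup_t ~` E t).
  apply: measurableC; apply: countable_bigcupT_measurable => // t.
  exact: measurableC.
apply/seteqP; split=> w /=; first by move=> h [t _]; exact.
by move=> h t; apply: contrapT => nE; apply: h; exists t.
Qed.

Lemma measurable_exists (T : countType) (E : T -> set Omega) :
  (forall t, measurable (E t)) -> measurable [set w | exists t, E t w].
Proof.
move=> mE; rewrite (_ : [set _ | _] = \bigcup_t E t).
  exact: countable_bigcupT_measurable.
apply/seteqP; split=> w /=; first by move=> [t Et]; exists t.
by move=> [t _ Et]; exists t.
Qed.

Lemma measurable_imply (A B : set Omega) : measurable A -> measurable B ->
  measurable [set w | A w -> B w].
Proof.
move=> mA mB; rewrite (_ : [set _ | _] = ~` A `|` B).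
  by apply: measurableU => //; exact: measurableC.
apply/seteqP; split=> w /=; last by move=> [nA /nA|].
by move=> AB; have [/AB|] := pselect (A w); [right|left].
Qed.

Lemma measurable_prop (Q : Prop) : measurable [set w : Omega | Q].
Proof. exact: (dmeasurable_cst tt (fun=> Q)). Qed.

Variables (N : Omega -> seq nat -> nat) (C : Omega -> seq nat -> nat * nat).
Hypothesis mN : forall v, dmeasurable (N ^~ v).
Hypothesis mC : forall v, dmeasurable (C ^~ v).

Lemma dmeasurable_spine n : dmeasurable (fun w => spine (N w) (C w) n).
Proof.
elim: n => [|[|n] ih]; first exact: dmeasurable_cst.
  exact: (dmeasurable_comp (fun k => [:: k.-1]) (mN [::])).
apply: (dmeasurable_bind (g := fun s w => rcons s (C w s).2)) ih _ => s.
exact: (dmeasurable_comp (fun c => rcons s c.2) (mC s)).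
Qed.

Lemma dmeasurable_special v : dmeasurable (fun w => special (N w) (C w) v).
Proof.
exact: (dmeasurable_comp (fun s => (v != [::]) && (v == s))
  (dmeasurable_spine (size v))).
Qed.

Lemma dmeasurable_nb_children v :
  dmeasurable (fun w => nb_children (N w) (C w) v).
Proof.
apply: (dmeasurable_bind (g := fun b w => if b then (C w v).1 else N w v)).
  exact: dmeasurable_special.
by move=> [|]; [exact: (dmeasurable_comp fst (mC v))|exact: mN].
Qed.

Lemma measurable_past v : measurable [set w | past (N w) (C w) v].
Proof.
have -> : [set w | past (N w) (C w) v] =
    [set w | forall u i, prefix (rcons u i) v ->
       (i < nb_children (N w) (C w) u)%N]
    `&` [set w | exists n, (0 < n)%N /\ ((fun s => v = s \/ exists i,
       ((C w s).2 < i)%N /\ prefix (rcons s i) v) (spine (N w) (C w) n))].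
  apply/seteqP; split=> w [vv].
    move=> [n n0 h]; split=> //; exists n; split=> //.
    by case: h => [|[i i1 i2]]; [left|right; exists i].
  move=> [n [n0 h]]; split=> //; exists n => //.
  by case: h => [|[i [i1 i2]]]; [left|right; exists i].
apply: measurableI.
  apply: measurable_forall => u; apply: measurable_forall => i.
  apply: measurable_imply; first exact: measurable_prop.
  exact: (dmeasurable_nb_children u (fun k => (i < k)%N)).
apply: measurable_exists => n; apply: measurableI; first exact: measurable_prop.
apply: (dmeasurable_bind (f := fun w => spine (N w) (C w) n)
  (g := fun s w => v = s \/ exists i, ((C w s).2 < i)%N /\ prefix (rcons s i) v)
  _ _ id).
  exact: dmeasurable_spine.
move=> s.
exact: (dmeasurable_comp (fun c : nat * nat => v = s \/
  exists i, (c.2 < i)%N /\ prefix (rcons s i) v) (mC s)).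
Qed.

Variables (V : countZmodType) (X : Omega -> seq nat -> V).
Hypothesis mX : forall v, dmeasurable (X ^~ v).

Lemma dmeasurable_walk x v : dmeasurable (fun w => walk (N w) (C w) (X w) x v).
Proof.
pose step w u := if special (N w) (C w) u then - X w u else X w u.
have mstep u : dmeasurable (step ^~ u).
  apply: (dmeasurable_bind (f := fun w => special (N w) (C w) u)
    (g := fun b w => if b then - X w u else X w u)).
    exact: dmeasurable_special.
  by move=> [|]; [exact: (dmeasurable_comp -%R (mX _))|exact: mX].
suff h (s : seq nat) : dmeasurable (fun w => \sum_(m <- s) step w (take m v)).
  exact: (dmeasurable_comp (fun z => x + z) (h _)).
elim: s => [|m s ih].
  by under eq_fun do rewrite big_nil; exact: dmeasurable_cst.
under eq_fun do rewrite big_cons.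
apply: (dmeasurable_bind (f := step ^~ (take m v))
  (g := fun z w => z + \sum_(m <- s) step w (take m v))) => // z.
exact: (dmeasurable_comp (fun z' => z + z') ih).
Qed.

Lemma measurable_past_avoids (K : {fset V}) x : measurable
  [set w | forall v, past (N w) (C w) v -> walk (N w) (C w) (X w) x v \notin K].
Proof.
apply: measurable_forall => v; apply: measurable_imply.
  exact: measurable_past.
exact: (dmeasurable_walk x v (fun z => z \notin K)).
Qed.

End discrete_measurability.

(** * The capacity as a limit *)

Section capacity_limit.
Context {R : realType} {d : nat} {mu : probability nat R}
  {theta : probability (Zd d) R} {dO : measure_display}
  {Omega : measurableType dO} {P : probability Omega R}
  {N : seq nat -> {RV P >-> nat}} {C : seq nat -> {RV P >-> (nat * nat)%type}}
  {X : seq nat -> {RV P >-> Zd d}}.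
Hypothesis hNCX : walk_choices N C X mu theta.
Variables (S : seq (Zd d)).
Hypothesis uS : uniq S.
Hypothesis thS : forall z, z \notin S -> step_law theta z = 0.

Section one_set.
Variable K : {fset Zd d}.

Let b := backbone_avoid mu theta S K.

Let avoid_event y : set Omega := [set w | forall v, past (N^~ w) (C^~ w) v ->
  walk (N^~ w) (C^~ w) (X^~ w) y v \notin K].

Let backbone_event y h : set Omega :=
  [set w | backbone (N^~ w) (C^~ w) (X^~ w) K h h [:: (N [::] w).-1] y].

Let mN v : dmeasurable (N v).
Proof. by move=> Q; rewrite -[X in measurable X]setTI; exact: measurable_funP. Qed.

Let mX v : dmeasurable (X v).
Proof. by move=> Q; rewrite -[X in measurable X]setTI; exact: measurable_funP. Qed.

Let mC v : dmeasurable (C v).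
Proof.
apply: dmeasurable_fibers => -[a c]; rewrite -[X in measurable X]setTI.
rewrite (_ : [set w | _] = C v @^-1` ([set a] `*` [set c])).
  by apply: measurable_funP => //; exact: measurableX.
by apply/seteqP; split=> w /=; [move=> ->|case: (C v w) => a' c' /= [-> ->]].
Qed.

Let measurable_avoid y : measurable (avoid_event y).
Proof.
exact: (@measurable_past_avoids _ _ (fun w => N^~ w) (fun w => C^~ w) mN mC _
  (fun w => X^~ w) mX).
Qed.

Let measurable_root h y : measurable (backbone_event y h).
Proof. exact: measurable_backbone_root. Qed.

(** A null event, outside of which the root has a child and every special rank is in range, as
    [past_avoidsP] requires. *)
Let bad : set Omega := [set w | N [::] w = 0%N] `|`
  \bigcup_v [set w | ((C v w).1 <= (C v w).2)%N].

Let measurable_rank v : measurable [set w | ((C v w).1 <= (C v w).2)%N].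
Proof. exact: (mC v (fun c => (c.1 <= c.2)%N)). Qed.

Let measurable_bad : measurable bad.
Proof.
apply: measurableU; first exact: (mN [::] (fun k => k = 0%N)).
exact: countable_bigcupT_measurable.
Qed.

Let prob_bad : P bad = 0%E.
Proof.
apply: measure_negligible => //; apply: negligibleU.
  apply/negligibleP; first exact: (mN [::] (fun k => k = 0%N)).
  exact: (prob_root_childless hNCX).
rewrite (_ : \bigcup_v _ = \bigcup_n
    (if @choice.pickle_inv (seq nat) n is Some v
     then [set w | ((C v w).1 <= (C v w).2)%N] else set0)).
  apply: negligible_bigcup => n; case: (choice.pickle_inv n) => [v|].
    by apply/negligibleP => //; exact: (prob_special_rank hNCX).
  exact: negligible_set0.
apply/seteqP; split=> w /=.
  by move=> [v _ vw]; exists (choice.pickle v) => //; rewrite pickleK_inv.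
by move=> [n _]; case: (choice.pickle_inv n) => // v vw; exists v.
Qed.

Let avoid_backbone y w : ~ bad w ->
  avoid_event y w <-> (\bigcap_h backbone_event y h) w.
Proof.
move=> /not_orP[/= N0 nC]; rewrite /avoid_event /= past_avoidsP.
- by split=> [h k _|h k]; exact: h.
- by rewrite lt0n; apply/eqP.
- by move=> v; rewrite ltnNge; apply/negP => vC; apply: nC; exists v.
Qed.

Lemma prob_avoid y :
  P (avoid_event y) = P (\bigcap_h backbone_event y h).
Proof.
have mB : measurable (\bigcap_h backbone_event y h).
  exact: bigcapT_measurable.
have sub (A B : set Omega) : measurable A -> measurable B ->
    (forall w, ~ bad w -> A w -> B w) -> (P A <= P B)%E.
  move=> mA mB' AB; apply: (@le_trans _ _ (P (B `|` bad))).
    apply: le_measure; rewrite ?inE//; first exact: measurableU.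
    by move=> w Aw; have [|nb] := pselect (bad w); [right|left; exact: AB].
  apply: (@le_trans _ _ (P B + P bad)%E); first exact: measureU2.
  by rewrite prob_bad adde0.
apply/eqP; rewrite eq_le; apply/andP; split; apply: sub => // w nb.
  by move/(avoid_backbone _ nb).
by move=> h; apply/(avoid_backbone _ nb).
Qed.

(** Continuity from above along the decreasing events indexed by h. *)
Lemma backbone_avoid_cvg y : b k k y @[k --> \oo] --> Es N C X K y.
Proof.
have mB : measurable (\bigcap_h backbone_event y h).
  exact: bigcapT_measurable.
have h : P (backbone_event y k) @[k --> \oo] --> P (\bigcap_h backbone_event y h).
  apply: nonincreasing_cvg_mu => //.
    by rewrite (le_lt_trans (probability_le1 _ _)) ?ltry.
  move=> m n mn; apply/subsetPset => w; exact: backbone_mono.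
rewrite /Es -/(avoid_event y) prob_avoid.
rewrite (_ : (fun k => _) = fine \o (fun k => P (backbone_event y k))).
  by apply: fine_cvg; rewrite fineK// fin_num_measure.
by apply/funext => k /=; rewrite (prob_backbone_root hNCX K uS thS).
Qed.

Lemma Es_le_backbone_avoid h n y : Es N C X K y <= b h n y.
Proof.
have bk k : (maxn h n <= k)%N -> b k k y <= b h n y.
  by rewrite geq_max => /andP[hk nk]; exact: (le_backbone_avoid hNCX K uS thS).
rewrite -(cvg_lim _ (@backbone_avoid_cvg y))//.
apply: limr_le; first exact: cvgP (@backbone_avoid_cvg y).
by exists (maxn h n) => // k /= hnk; exact: bk.
Qed.

Let total n := \sum_(i < n) \sum_(y <- K) b i (n - i) y.

(** Each term lies between the escape probability and a diagonal value at i or n - i; the diagonal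
    means converge by Cesaro. *)
Lemma BCap_cvg : total n.+1 / n.+1%:R @[n --> \oo] --> BCap N C X K.
Proof.
pose a k := \sum_(y <- K) b k k y.
have a_cvg : a @ \oo --> BCap N C X K.
  rewrite /a /BCap; elim: (K : seq _) => [|y s ih].
    by under eq_fun do rewrite big_nil; rewrite big_nil; exact: cvg_cst.
  under eq_fun do rewrite big_cons; rewrite big_cons.
  by apply: cvgD => //; exact: backbone_avoid_cvg.
have am := cesaro a_cvg.
have BE n : BCap N C X K * n.+1%:R = \sum_(i < n.+1) BCap N C X K.
  by rewrite sumr_const card_ord mulr_natr.
apply: (@squeeze_cvgr _ _ _ _ (fun=> BCap N C X K)
  (fun n => 2 * arithmetic_mean a n - BCap N C X K)).
- near=> n; apply/andP; split.
    rewrite ler_pdivlMr// BE.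
    by apply: ler_sum => i _; apply: ler_sum => y _; exact: Es_le_backbone_avoid.
  have aE : arithmetic_mean a n * n.+1%:R = \sum_(i < n.+1) a i.
    by rewrite /arithmetic_mean/= mulrAC mulVf// mul1r /series/= big_mkord.
  rewrite ler_pdivrMr// mulrBl -mulrA aE BE mulr_natl mulr2n.
  (* One of the two copies of the diagonal sum is read backwards, pairing i with n - i. *)
  rewrite [X in _ + X - _](reindex_inj rev_ord_inj)/= -big_split/= -sumrB.
  apply: ler_sum => i _; rewrite /a /BCap -big_split/= -sumrB.
  apply: ler_sum => y _; rewrite subSS.
  have le := @le_backbone_avoid _ _ _ _ _ _ _ _ _ _ hNCX _ K uS thS.
  have iE := Es_le_backbone_avoid i i y.
  have nE := Es_le_backbone_avoid (n - i) (n - i) y.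
  (* One diagonal value bounds the term; the other is at least the escape probability that is
     subtracted. *)
  have [ni|ni] := leqP i (n.+1 - i).
    have := le i i i (n.+1 - i)%N y (leqnn _) ni; rewrite -/b; lra.
  have := le (n - i)%N i (n - i)%N (n.+1 - i)%N y _ _; rewrite -/b => h.
  have {}h : b i (n.+1 - i) y <= b (n - i) (n - i) y by apply: h; lia.
  lra.
- exact: cvg_cst.
- rewrite [X in _ --> X](_ : _ = 2 * BCap N C X K - BCap N C X K); last by ring.
  by apply: cvgB; [exact: cvgMl_tmp|exact: cvg_cst].
Unshelve. all: by end_near.
Qed.

End one_set.
(** A limit of the truncated exponentials, taken with t = u / (n + 1). *)
Lemma cmon_expR_BCap (u : R) : 0 <= u ->
  cmon (fun K => expR (- (u * BCap N C X K))).
Proof.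
move=> u0; apply: (@cmon_lim _ _ (fun n K => expR (- (u / n.+1%:R *
    \sum_(i < n.+1) \sum_(y <- K) backbone_avoid mu theta S K i (n.+1 - i) y)))).
  move=> n; apply: cmon_expR_backbone.
  - exact: (esum_genfun hNCX).
  - by move=> K; exact: (bush_avoid_ge0_le1 hNCX K uS thS).
  - exact: sum_step_law.
  - by move=> K h m y; have /andP[] := backbone_avoid_ge0_le1 hNCX K uS thS h m y.
  - by rewrite divr_ge0.
move=> K; have h : - (u / n.+1%:R * \sum_(i < n.+1)
    \sum_(y <- K) backbone_avoid mu theta S K i (n.+1 - i) y) @[n --> \oo] -->
    - (u * BCap N C X K).
  apply: cvgN; rewrite (_ : (fun n => _) = fun n => u * ((\sum_(i < n.+1)
    \sum_(y <- K) backbone_avoid mu theta S K i (n.+1 - i) y) / n.+1%:R)).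
    by apply: cvgMl_tmp; exact: BCap_cvg.
  by apply/funext => n; rewrite mulrAC mulrA.
by apply: cvg_comp h _; exact: continuous_expR.
Qed.

End capacity_limit.

Lemma step_law_support (R : realType) (d : nat) (theta : probability (Zd d) R)
    (A : set (Zd d)) z : theta A = 1%E -> ~ A z -> step_law theta z = 0.
Proof.
move=> A1 Az; rewrite /step_law.
suff -> : theta [set z] = 0%E by [].
apply/eqP; rewrite -measure_le0.
apply: (@le_trans _ _ (theta (~` A))).
  by apply: le_measure; rewrite ?inE// => _ ->.
by rewrite probability_setC// A1 subee.
Qed.

Theorem theorem1 (R : realType) (d : nat) (hd : (5 <= d)%N)
  (mu : probability nat R) (hmu : critical_offspring mu)
  (theta : probability (Zd d) R) (htheta : centered_step theta)
  (dO : measure_display) (Omega : measurableType dO) (P : probability Omega R)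
  (N : seq nat -> {RV P >-> nat}) (C : seq nat -> {RV P >-> (nat * nat)%type})
  (X : seq nat -> {RV P >-> Zd d}) (hNCX : walk_choices N C X mu theta)
  (u : R) (hu : 0 < u) :
  (exists (d1 : measure_display) (O1 : measurableType d1)
     (Q : probability O1 R) (I : {RV Q >-> subsets d}),
     forall K : {fset Zd d},
       Q [set w | avoids (I w) K] = (expR (- (u * BCap N C X K)))%:E) /\
  (forall (d1 d2 : measure_display) (O1 : measurableType d1)
     (O2 : measurableType d2) (Q1 : probability O1 R) (Q2 : probability O2 R)
     (I1 : {RV Q1 >-> subsets d}) (I2 : {RV Q2 >-> subsets d}),
     (forall K : {fset Zd d},
        Q1 [set w | avoids (I1 w) K] = (expR (- (u * BCap N C X K)))%:E) ->
     (forall K : {fset Zd d},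
        Q2 [set w | avoids (I2 w) K] = (expR (- (u * BCap N C X K)))%:E) ->
     forall B : set (subsets d), measurable B ->
       distribution Q1 I1 B = distribution Q2 I2 B).
Proof.
have [_ [A fA A1] _] := htheta.
(* The finite set carrying theta, listed without repetition, serves as S. *)
have thS z : z \notin fset_set A -> step_law theta z = 0.
  move=> zA; apply: step_law_support A1 _ => Az.
  by move: zA; rewrite in_fset_set// => /negP; apply; exact/mem_set.
have cm : cmon (fun K => expR (- (u * BCap N C X K))).
  exact: (cmon_expR_BCap hNCX (fset_uniq _) thS (ltW hu)).
split; last first.
  move=> d1 d2 O1 O2 Q1 Q2 I1 I2 h1 h2; apply: eq_random_subset_law => K.
  by rewrite h1 h2.
apply: ex_random_subset cm _.
(* The empty set has capacity 0, so the initial interval is [0, 1[. *)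
by rewrite /BCap big_seq_fset0 mulr0 oppr0 expR0.
Qed.
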